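(* Let $X$ and $Y$ be two finite digraphs and let $\Delta_p^{(a)}$ denote the normalized Hodge Laplacian (corresponding to the weight $a_p=p!$). Then, for any $r\ge0$, $$\operatorname{spec}\Delta_r^{(a)}(X\Box Y)=\bigsqcup_{\{p,q\ge0:\,p+q=r\}}\Big(\operatorname{spec}\Delta_p^{(a)}(X)+\operatorname{spec}\Delta_q^{(a)}(Y)\Big).$$
   Context: A digraph $G=(V,E)$ consists of a finite vertex set $V$ and a set $E$ of ordered pairs of distinct vertices (arrows), written $i\to j$. An elementary $p$-path ($p\ge 0$) is a sequence $i_0\dots i_p$ of vertices, with associated basis symbol $e_{i_0\dots i_p}$; it is regular if $i_{k-1}\ne i_k$ for all $k$, and allowed if $i_{k-1}\to i_k$ for all $k$. $\mathcal R_p$ is the real vector space with basis the regular elementary $p$-paths. The boundary operator $\partial:\mathcal R_p\to\mathcal R_{p-1}$ is $\partial e_{i_0\dots i_p}=\sum_{k=0}^p(-1)^k e_{i_0\dots\widehat{i_k}\dots i_p}$, where every non-regular term on the right is replaced by $0$; and $\mathcal R_{-1}=\{0\}$, $\partial e_i=0$. $\mathcal A_p\subset\mathcal R_p$ is the span of the allowed elementary $p$-paths ($\mathcal A_{-1}=\{0\}$), and $\Omega_p=\Omega_p(G)=\{u\in\mathcal A_p:\partial u\in\mathcal A_{p-1}\}$. Then $\partial\Omega_p\subset\Omega_{p-1}$ and $\partial^2=0$. Normalized Hodge Laplacian: equip $\mathcal R_p$ with the inner product for which distinct regular elementary $p$-paths are orthogonal and each has squared norm $\frac{1}{p!}$,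 restrict it to $\Omega_p$, let $\partial_a^*:\Omega_{p-1}\to\Omega_p$ be the adjoint of $\partial:\Omega_p\to\Omega_{p-1}$, and put $\Delta_p^{(a)}(G)=\partial\partial_a^*+\partial_a^*\partial:\Omega_p\to\Omega_p$. The Cartesian product $X\Box Y$ of digraphs has vertex set $X\times Y$, with $(x_1,y_1)\to(x_2,y_2)$ iff either $x_1=x_2$ and $y_1\to y_2$, or $x_1\to x_2$ and $y_1=y_2$. $\operatorname{spec}A$ is the multiset of eigenvalues of the self-adjoint operator $A$, counted with multiplicity. $\sqcup$ is disjoint union of multisets (multiplicities add), and the sum of multisets is $\{\lambda_i\}+\{\mu_j\}=\{\lambda_i+\mu_j\}$ over all pairs $(i,j)$ (empty if one of them is empty). *)

(* Defs.v *)
From HB Require Import structures.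
From mathcomp Require Import all_boot all_order all_algebra.
From mathcomp Require Import zify polyrcf.
From mathcomp Require Import classical_sets reals.

Set Implicit Arguments.
Unset Strict Implicit.
Unset Printing Implicit Defensive.

Import Order.TTheory GRing.Theory Num.Theory.
Local Open Scope ring_scope.

Record digraph := Digraph {
  vertex :> finType;
  arrow : rel vertex;
  arrow_irr : irreflexive arrow }.

Section CartesianProduct.
Variables X Y : digraph.

Definition box_arrow : rel (X * Y)%type := fun u v =>
  ((u.1 == v.1) && arrow u.2 v.2) || (arrow u.1 v.1 && (u.2 == v.2)).

Lemma box_arrow_irr : irreflexive box_arrow.
Proof. by move=> u; rewrite /box_arrow !arrow_irr andbF. Qed.

Definition box : digraph := Digraph box_arrow_irr.

End CartesianProduct.

Section PathComplex.
Variables (R : realType) (G : digraph).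

Definition regular (s : seq G) : bool := sorted (fun i j => i != j) s.

Definition allowed (s : seq G) : bool := sorted (@arrow G) s.

(* A p-path i_0 ... i_p has p + 1 vertices. *)
Definition rpath (p : nat) := {s : p.+1.-tuple G | regular s}.

Definition chain (p : nat) := {ffun rpath p -> R^o}.

(* The basis vector of the sequence s; it is 0 if s is not a regular
   elementary p-path, which implements the convention on non-regular terms. *)
Definition elem (p : nat) (s : seq G) : chain p :=
  [ffun t => (val (val t) == s)%:R].

Definition face (k : nat) (s : seq G) : seq G := take k s ++ drop k.+1 s.

Definition bd_elem (p : nat) (s : seq G) : chain p.-1 :=
  \sum_(k < p.+1) (-1) ^+ k *: elem p.-1 (face k s).

(* For p = 0 the codomain chain 0 stands for R_{-1} = 0: the only face of a
   0-path is the empty sequence, so that the map is 0 (lemma boundary0). *)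
Definition bd_fun (p : nat) (u : chain p) : chain p.-1 :=
  \sum_(t : rpath p) u t *: bd_elem p (val (val t)).

Lemma bd_fun_linear p : linear (@bd_fun p).
Proof.
move=> a u v; rewrite /bd_fun scaler_sumr -big_split; apply: eq_bigr => t _.
by rewrite !ffunE scalerDl scalerA.
Qed.

HB.instance Definition _ p :=
  GRing.isLinear.Build R (chain p) (chain p.-1) _ (@bd_fun p) (@bd_fun_linear p).

Definition boundary (p : nat) : 'Hom(chain p, chain p.-1) := linfun (@bd_fun p).

Lemma elem_nreg p s : ~~ regular s -> elem p s = 0.
Proof.
move=> nrs; apply/ffunP=> t; rewrite !ffunE; case: eqP => // ts.
by rewrite -ts (valP t) in nrs.
Qed.

Lemma elem_size p s : size s != p.+1 -> elem p s = 0.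
Proof.
move=> szs; apply/ffunP=> t; rewrite !ffunE; case: eqP => // ts.
by rewrite -ts size_tuple eqxx in szs.
Qed.

Lemma size_face k s : (k < size s)%N -> size (face k s) = (size s).-1.
Proof. by move=> ks; rewrite size_cat size_drop size_takel; lia. Qed.

Lemma chainE p (u : chain p) : u = \sum_t u t *: elem p (val (val t)).
Proof.
apply/ffunP=> t; rewrite sum_ffunE (bigD1 t) //= big1 ?addr0.
  by rewrite !ffunE eqxx [_ *: _]mulr1.
move=> i it; rewrite !ffunE; case: eqP; last by rewrite scaler0.
by move=> /val_inj/val_inj ti; rewrite ti eqxx in it.
Qed.

Lemma nth_face x k s j :
  (k < size s)%N -> nth x (face k s) j = nth x s (bump k j).
Proof.
move=> ks; rewrite nth_cat (size_takel (ltnW ks)) /bump.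
case: (ltnP j k) => jk; first by rewrite nth_take.
by rewrite nth_drop; congr nth; lia.
Qed.

Lemma regularP x s :
  reflect (forall i, (i.+1 < size s)%N -> nth x s i != nth x s i.+1) (regular s).
Proof.
apply: (iffP idP) => [|H]; first by move=> /(sortedP x).
exact/(sortedP x).
Qed.

Lemma bd_elem_nreg p s : size s = p.+1 -> ~~ regular s -> bd_elem p s = 0.
Proof.
case: s => [|x s'] //; set s := x :: s' => szs nrs.
have [i isz ei] : exists2 i, (i.+1 < p.+1)%N & nth x s i = nth x s i.+1.
  have [/existsP[i /andP[h1 /eqP h2]]|/existsPn H] :=
    boolP [exists i : 'I_p.+1, (i.+1 < p.+1)%N && (nth x s i == nth x s i.+1)].
    by exists i.
  case/negP: nrs; apply/(regularP x) => i; rewrite szs => hi.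
  by have := H (Ordinal (ltnW hi)); rewrite /= hi.
have ip : (i < p.+1)%N by rewrite ltnW.
rewrite /bd_elem (bigD1 (Ordinal ip)) //= (bigD1 (Ordinal isz)) /=; last first.
  by rewrite -val_eqE /= eqn_leq ltnn.
rewrite big1 ?addr0 => [|k /andP[]]; last first.
  rewrite -!val_eqE /= => /eqP ki /eqP ki1.
  rewrite elem_nreg ?scaler0//; apply/negP => /(regularP x) H.
  have kp := ltn_ord k.
  have := H (unbump k i); rewrite size_face szs // !nth_face ?szs //.
  have -> : bump k (unbump k i) = i by rewrite /bump /unbump; lia.
  have -> : bump k (unbump k i).+1 = i.+1 by rewrite /bump /unbump; lia.
  by rewrite ei eqxx => /(_ ltac:(rewrite /unbump; lia)).
suff -> : face i.+1 s = face i s.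
  by rewrite exprS mulN1r scaleNr subrr.
apply: (@eq_from_nth _ x); first by rewrite !size_face ?szs.
move=> j _; rewrite !nth_face ?szs //.
have [->|ji] := eqVneq j i; first by rewrite /bump leqnn ltnn.
by congr nth; rewrite /bump; lia.
Qed.

Lemma bd_elemE p s : size s = p.+1 -> boundary p (elem p s) = bd_elem p s.
Proof.
move=> szs; rewrite lfunE /= /bd_fun.
have [rs|nrs] := boolP (regular s); last first.
  rewrite bd_elem_nreg // big1 // => t _.
  by rewrite elem_nreg // ffunE scale0r.
have szs' : size s == p.+1 by rewrite szs.
pose t : rpath p := Sub (Tuple szs') rs.
rewrite (bigD1 t) //= big1 ?addr0 => [|i it].
  by rewrite ffunE /= eqxx scale1r.
rewrite ffunE; case: eqP; last by rewrite scale0r.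
by move=> ts; case/eqP: it; apply/val_inj/val_inj.
Qed.

Lemma boundary0 : boundary 0 = 0.
Proof.
apply/lfunP=> u; rewrite !lfunE /= /bd_fun big1 // => t _.
rewrite /bd_elem big_ord_recl big_ord0 addr0 elem_size ?scaler0//.
by rewrite size_face size_tuple.
Qed.

Lemma boundary_bd_elem q s : size s = q.+2 -> boundary q (bd_elem q.+1 s) = 0.
Proof.
move=> szs; rewrite {1}/bd_elem linear_sum /=.
rewrite (eq_bigr (fun k : 'I_q.+2 => \sum_(j < q.+1)
  (-1) ^+ (k + j) *: elem q.-1 (face j (face k s)))); last first.
  move=> k _; rewrite linearZ /= bd_elemE ?size_face ?szs //.
  rewrite /bd_elem scaler_sumr; apply: eq_bigr => j _.
  by rewrite scalerA exprD.
rewrite pair_bigA /= (bigID (fun x : 'I_q.+2 * 'I_q.+1 => (x.2 < x.1)%N)) /=.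
rewrite [X in _ + X](reindex_onto
  (fun x : 'I_q.+2 * 'I_q.+1 => (inord x.2, inord x.1.-1))
  (fun x : 'I_q.+2 * 'I_q.+1 => (inord x.2.+1, inord x.1))) /=; last first.
  case=> k j /=; rewrite -leqNgt => kj; have := ltn_ord j => hj.
  by congr (_, _); apply/val_inj; rewrite /= !inordK //= ?inordK //; lia.
set P := (X in _ + \sum_(i | X i) _).
have PE : P =1 (fun x => (x.2 < x.1)%N).
  case=> k j; rewrite /P /=; have := ltn_ord j; have := ltn_ord k => hk hj.
  rewrite inordK; last by lia.
  have [jk|kj] := ltnP j k.
    rewrite inordK; last by lia.
    rewrite -leqNgt -ltnS prednK ?jk /=; last by lia.
    apply/eqP; congr (_, _); apply/val_inj; rewrite /= !inordK //= ?inordK //; lia.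
  apply/negbTE/negP => /andP[h /eqP[]] /(congr1 val) /= + /(congr1 val) /=.
  by rewrite -leqNgt !inordK in h *; lia.
rewrite (eq_bigl _ _ PE) -big_split big1 //= => -[k j] /= jk.
have := ltn_ord j; have := ltn_ord k => hk hj.
rewrite !inordK; [|lia..].
have -> : face k.-1 (face j s) = face j (face k s).
  case: s szs => [//|x s'] szs; apply: (@eq_from_nth _ x).
    by rewrite !size_face ?size_face ?szs //=; lia.
  move=> i _; rewrite !nth_face ?size_face ?szs //=; try lia.
  by congr nth; rewrite /bump; lia.
have -> : (k + j = (j + k.-1).+1)%N by lia.
by rewrite exprS mulN1r scaleNr addrC subrr.
Qed.

Lemma boundaryK p (u : chain p) : boundary p.-1 (boundary p u) = 0.
Proof.
case: p u => [|q] u; first by rewrite boundary0 !lfunE.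
rewrite (chainE u) !linear_sum big1 // => t _.
by rewrite !linearZ /= bd_elemE ?size_tuple // boundary_bd_elem ?size_tuple ?scaler0.
Qed.

Definition A_ (p : nat) : {vspace chain p} :=
  (\sum_(t : rpath p | allowed (val (val t))) <[elem p (val (val t))]>)%VS.

Definition Omega (p : nat) : {vspace chain p} :=
  (A_ p :&: boundary p @^-1: A_ p.-1)%VS.

Lemma boundary_Omega p u : u \in Omega p -> boundary p u \in Omega p.-1.
Proof.
rewrite !memv_cap => /andP[_]; rewrite -memv_preim => ->.
by rewrite -memv_preim boundaryK mem0v.
Qed.

Definition boundaryO (p : nat) : 'Hom(subvs_of (Omega p), subvs_of (Omega p.-1)) :=
  (linfun (vsproj (Omega p.-1)) \o boundary p \o linfun vsval)%VF.

Lemma boundaryOE p u : vsval (boundaryO p u) = boundary p (vsval u).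
Proof.
rewrite comp_lfunE /= comp_lfunE /= (lfunE vsval) (lfunE (vsproj _)) /=.
by rewrite vsprojK // boundary_Omega // subvsP.
Qed.

(* Distinct regular elementary p-paths are orthogonal, of squared norm 1/p!. *)
Definition inner (p : nat) (u v : chain p) : R :=
  (p`!%:R)^-1 * \sum_(t : rpath p) u t * v t.

Lemma innerC p (u v : chain p) : inner u v = inner v u.
Proof. by congr (_ * _); apply: eq_bigr => t _; rewrite mulrC. Qed.

Lemma innerDl p a (u v w : chain p) :
  inner (a *: u + v) w = a * inner u w + inner v w.
Proof.
rewrite /inner mulrCA -mulrDr; congr (_ * _).
rewrite mulr_sumr -big_split; apply: eq_bigr => t _.
by rewrite !ffunE mulrDl mulrA.
Qed.

Lemma inner0l p (u : chain p) : inner 0 u = 0.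
Proof. by rewrite /inner big1 ?mulr0 // => t _; rewrite ffunE mul0r. Qed.

Lemma innerZl p a (u v : chain p) : inner (a *: u) v = a * inner u v.
Proof. by rewrite -[a *: u]addr0 innerDl inner0l addr0. Qed.

Lemma inner_suml p (I : finType) (F : I -> chain p) v :
  inner (\sum_i F i) v = \sum_i inner (F i) v.
Proof.
elim/big_rec2: _ => [|i x y _ <-]; first exact: inner0l.
by rewrite -[F i]scale1r innerDl mul1r scale1r.
Qed.

Lemma inner_eq0 p (u : chain p) : inner u u = 0 -> u = 0.
Proof.
move/eqP; rewrite mulf_eq0 invr_eq0 pnatr_eq0 (negbTE (lt0n_neq0 (fact_gt0 p))) /=.
rewrite psumr_eq0 => [/allP H|t _]; last by rewrite -expr2 sqr_ge0.
apply/ffunP=> t; have := H t (mem_index_enum t).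
by rewrite mulf_eq0 orbb ffunE => /eqP.
Qed.

Section Adjoint.
Variables (p q : nat) (U : {vspace chain p}) (W : {vspace chain q}).
Implicit Type f : 'Hom(subvs_of U, subvs_of W).

Definition is_adjoint f (g : 'Hom(subvs_of W, subvs_of U)) : Prop :=
  forall u w, inner (vsval (f u)) (vsval w) = inner (vsval u) (vsval (g w)).

Lemma is_adjoint_unique f g h : is_adjoint f g -> is_adjoint f h -> g = h.
Proof.
move=> fg fh; apply/lfunP=> w; apply/val_inj/eqP; rewrite -subr_eq0; apply/eqP.
have gh (u : subvs_of U) : inner (vsval u) (vsval (g w)) = inner (vsval u) (vsval (h w)).
  exact: etrans (esym (fg u w)) (fh u w).
have gh0 (u : subvs_of U) : inner (vsval u) (vsval (g w) - vsval (h w)) = 0.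
  rewrite innerC addrC -scaleN1r innerDl mulN1r !(innerC _ (vsval u)).
  by rewrite gh addNr.
by apply: inner_eq0; have := gh0 (g w - h w); rewrite linearB.
Qed.

Lemma is_adjoint_exists f : exists g, is_adjoint f g.
Proof.
pose n := \dim {:subvs_of U}; pose b := vbasis {:subvs_of U}.
pose F (v : chain p) : 'rV[R]_n := \row_i inner v (vsval b`_i).
pose H (w : chain q) : 'rV[R]_n := \row_i inner w (vsval (f b`_i)).
have Flin : linear F by move=> a u v; apply/rowP=> i; rewrite !mxE innerDl.
have Hlin : linear H by move=> a u v; apply/rowP=> i; rewrite !mxE innerDl.
pose Fl : {linear chain p -> 'rV[R]_n} := HB.pack F
  (GRing.isLinear.Build R (chain p) 'rV[R]_n _ F Flin).
pose Hl : {linear chain q -> 'rV[R]_n} := HB.pack H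
  (GRing.isLinear.Build R (chain q) 'rV[R]_n _ H Hlin).
pose phi : 'Hom(subvs_of U, 'rV[R]_n) := (linfun Fl \o linfun vsval)%VF.
pose psi : 'Hom(subvs_of W, 'rV[R]_n) := (linfun Hl \o linfun vsval)%VF.
have phiE u : phi u = F (vsval u).
  by rewrite comp_lfunE /= (lfunE vsval) (lfunE Fl).
have psiE w : psi w = H (vsval w).
  by rewrite comp_lfunE /= (lfunE vsval) (lfunE Hl).
have ext (v : chain p) (w : chain q) : F v = H w ->
    forall u, inner (vsval u) v = inner (vsval (f u)) w.
  move=> FH u; rewrite (coord_vbasis (memvf u)) !linear_sum /=.
  rewrite !inner_suml; apply: eq_bigr => i _.
  rewrite !linearZ /= !innerZl; congr (_ * _).
  by have := congr1 (fun r : 'rV_n => r 0 i) FH; rewrite !mxE innerC => ->; rewrite innerC.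
have phi0 : lker phi == 0%VS.
  rewrite -subv0; apply/subvP => u; rewrite memv_ker memv0 phiE => /eqP Fu.
  apply/eqP/val_inj/inner_eq0; rewrite (ext _ 0) ?Fu.
    by rewrite innerC inner0l.
  by apply/rowP => i; rewrite !mxE inner0l.
have phif : limg phi = fullv.
  apply/eqP; rewrite eqEdim subvf limg_dim_eq ?(eqP phi0) ?capv0 //.
  have -> : \dim {:'rV[R]_n} = n by rewrite dimvf dim_matrix; lia.
  exact: leqnn.
exists (phi^-1 \o psi)%VF => u w; rewrite comp_lfunE /=.
by apply/esym/ext; rewrite -phiE limg_lfunVK ?phif ?memvf.
Qed.

Definition adjoint f : 'Hom(subvs_of W, subvs_of U) := xget 0 (is_adjoint f).

Lemma adjointP f : is_adjoint f (adjoint f).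
Proof. exact: (xgetPex _ (is_adjoint_exists f)). Qed.

End Adjoint.

Definition Laplacian (p : nat) : 'End(subvs_of (Omega p)) :=
  ((boundaryO p.+1 \o adjoint (boundaryO p.+1)) +
   (adjoint (boundaryO p) \o boundaryO p))%VF.

End PathComplex.

Arguments Laplacian R G p : clear implicits.

Section Spectrum.
Variables (R : realType) (vT : vectType R) (f : 'End(vT)).

Definition char_pol : {poly R} :=
  char_poly (passmx.mxof (vbasis {:vT}) (vbasis {:vT}) f).

(* Multisets are represented by sequences up to perm_eq. *)
Definition spec : seq R :=
  flatten [seq nseq (mup x char_pol) x | x <- rootsR char_pol].

Lemma count_spec x : count_mem x spec = mup x char_pol.
Proof.
have c0 : char_pol != 0 by apply/monic_neq0/char_poly_monic.
have rootE y : (y \in rootsR char_pol) = root char_pol y.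
  by have := roots_on_rootsR c0 y; rewrite in_itv /= => ->.
have cnt s : uniq s ->
    count_mem x (flatten [seq nseq (mup y char_pol) y | y <- s]) =
    if x \in s then mup x char_pol else 0%N.
  elim: s => //= y s IHs /andP[ys us]; rewrite count_cat IHs // count_nseq /=.
  have [<-|yx] := eqVneq y x.
    by rewrite inE eqxx (negbTE ys) mul1n addn0.
  by rewrite inE eq_sym (negbTE yx) mul0n.
rewrite cnt; last by rewrite /rootsR uniq_roots.
by rewrite rootE; case: ifPn => // /mupNroot.
Qed.

End Spectrum.

Definition msum (R : realType) (s t : seq R) : seq R :=
  [seq x + y | x <- s, y <- t].

(* Main.v *)
From HB Require Import structures.
Require Import Defs.
From mathcomp Require Import all_boot all_order all_algebra.
From mathcomp Require Import zify ring complex boolp reals.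

Set Implicit Arguments.
Unset Strict Implicit.
Unset Printing Implicit Defensive.

Import Order.TTheory GRing.Theory Num.Theory.
Local Open Scope ring_scope.

(** Write Omega_p for the space [Omega R _ p]. The theorem is a Kunneth formula
    at chain level together with the remark that, for the weights p!, it is
    isometric.

    The cross product of a p-path x of X and a q-path y of Y is the signed sum
    of all staircases in the box product whose projections are x and y; the
    sign of a staircase is the parity of the area under it. Extended
    bilinearly it has four properties.

    - Leibniz rule [boundary_cross]: the boundary of u x v is
      (boundary u) x v + (-1)^p u x (boundary v). Deleting a corner of a
      staircase leaves a diagonal step, which arises from exactly two
      staircases, of opposite signs; deleting any other vertex deletes a vertex
      of x or of y. Hence cross products of elements of Omega_p and Omega_q are
      in Omega_(p+q).

    - Isometry [inner_cross]: two given paths have (p+q choose p) staircases,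
      and (p+q choose p) / (p+q)! = 1 / (p! q!), so that
      (u x v, u' x v') = (u, u') (v, v').

    - Surjectivity [Omega_cross_orth]: cross products span Omega_r of the box
      product. For w in Omega_r the coefficient of the boundary of w at a path
      with one diagonal step vanishes, so flipping a corner changes the sign of the
      coefficient of w; hence w is determined by a function c (x, y) of pairs
      of paths. Comparing boundaries once more, all slices c (., y) and
      c (x, .) are in the spaces Omega of the factors. If w is orthogonal to
      all cross products then these slices are orthogonal to
      the corresponding Omega, so w = 0.

    - Leibniz rule for the adjoint [delta_cross]. By surjectivity it may be
      tested against cross products, where it follows from the first two
      properties.

    The mixed terms of the two Leibniz rules cancel in the Laplacian, so
    Delta (u x v) = (Delta u) x v + u x (Delta v) [Laplacian_cross]. The
    Laplacian is symmetric, hence has an orthogonal eigenbasis on each factor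
    [Laplacian_eigenbasis]; the cross products of these bases form an
    orthogonal basis of Omega_r of the box product, made of eigenvectors for
    the sums of the eigenvalues, and a basis of eigenvectors determines the
    spectrum [spec_eigenbasis]. *)

Local Notation nrep := (path (fun i j => i != j)).

(** * Boundaries of coefficient functions *)

Section Insertion.
Variables (R : comNzRingType) (V : finType).
Implicit Types (f : seq V -> R) (s : seq V).

(** If f gives the coefficients of a chain, then [ins f s] is the coefficient
    of its boundary at a nonempty regular path s: the sum, over all ways of inserting one vertex into s,
    of the coefficients of the results, signed by the position of insertion. The
    recursion on s separates insertion at the front from insertion further
    on, and is the form in which the boundary meets the recursive definition of
    staircases below. *)
Fixpoint ins f s : R :=
  if s is a :: s' then \sum_v f (v :: s) - ins (fun t => f (a :: t)) s'
  else \sum_v f [:: v].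

Lemma eq_ins f1 f2 s :
  (forall t, size t = (size s).+1 -> f1 t = f2 t) -> ins f1 s = ins f2 s.
Proof.
elim: s f1 f2 => [|a s IHs] f1 f2 f12 /=.
  by apply: eq_bigr => v _; apply: f12.
congr (_ - _); first by apply: eq_bigr => v _; apply: f12.
by apply: IHs => t sz; rewrite f12 //= sz.
Qed.

Lemma ins_cons f a s :
  ins f (a :: s) = \sum_v f (v :: a :: s) - ins (fun t => f (a :: t)) s.
Proof. by []. Qed.

Lemma insZ c f s : ins (fun t => c * f t) s = c * ins f s.
Proof.
elim: s f => [|a s IHs] f /=; first by rewrite mulr_sumr.
by rewrite IHs mulrBr mulr_sumr.
Qed.

Lemma ins0 f s : (forall t, size t = (size s).+1 -> f t = 0) -> ins f s = 0.
Proof.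
elim: s f => [|a s IHs] f f0 /=; first by rewrite big1 // => v _; rewrite f0.
rewrite big1 ?IHs ?subr0 // => [t sz|v _]; last by rewrite f0.
by rewrite f0 //= sz.
Qed.

(** Summation over all sequences of length n, by recursion so that it unfolds
    along the first step of a path. *)
Fixpoint sumseq n f : R :=
  if n is n'.+1 then \sum_a sumseq n' (fun s => f (a :: s)) else f [::].

Lemma eq_sumseq n f1 f2 :
  (forall s, size s = n -> f1 s = f2 s) -> sumseq n f1 = sumseq n f2.
Proof.
elim: n f1 f2 => [|n IHn] f1 f2 f12 /=; first exact: f12.
by apply: eq_bigr => a _; apply: IHn => s sz; rewrite f12 //= sz.
Qed.

Lemma sumseq0 n f : (forall s, size s = n -> f s = 0) -> sumseq n f = 0.
Proof.
elim: n f => [|n IHn] f f0 /=; first exact: f0.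
by rewrite big1 // => a _; apply: IHn => s sz; rewrite f0 //= sz.
Qed.

Lemma sumseqZ n c f : sumseq n (fun s => c * f s) = c * sumseq n f.
Proof.
elim: n f => //= n IHn f; rewrite mulr_sumr.
by apply: eq_bigr => a _; rewrite IHn.
Qed.

Lemma sumseq_sum n (I : finType) (P : pred I) (F : I -> seq V -> R) :
  sumseq n (fun s => \sum_(i | P i) F i s) = \sum_(i | P i) sumseq n (F i).
Proof.
elim: n F => //= n IHn F; rewrite exchange_big.
by apply: eq_bigr => a _; rewrite IHn.
Qed.

End Insertion.

(** * Cross products along staircases *)

Section Shuffle.
Variables (R : comNzRingType) (X Y : finType).
Implicit Types (g h : seq X -> seq Y -> R) (s : seq X) (t : seq Y).
Implicit Types (z : seq (X * Y)).

(** The cross product read off along a path of the box product which stands at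
    (a, b) and has z still to follow. The argument g s t is the coefficient of the
    pair of paths which continue with s from a and with t from b. A step in the
    second coordinate contributes a sign for each later step in
    the first one; the total sign is the parity of the number of unit squares
    under the staircase. A step that changes both coordinates or none gives
    0. *)
Fixpoint shuffle g a b z : R :=
  if z is (a', b') :: z' then
    if b' == b then
      if a' == a then 0 else shuffle (fun s t => g (a' :: s) t) a' b z'
    else if a' == a then shuffle (fun s t => (-1) ^+ size s * g s (b' :: t)) a b' z'
    else 0
  else g [::] [::].

Lemma eq_shuffle g h a b z :
  (forall s t, nrep a s -> nrep b t -> g s t = h s t) ->
  shuffle g a b z = shuffle h a b z.
Proof.
elim: z g h a b => [|[a' b'] z IHz] g h a b gh /=; first exact: gh.
case: (eqVneq b' b) => [_|bb]; case: (eqVneq a' a) => [_|aa] //.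
  by apply: IHz => s t rs rt; apply: gh; rewrite //= eq_sym aa.
by apply: IHz => s t rs rt; rewrite gh //= eq_sym bb.
Qed.

Lemma shuffleZD c g h a b z :
  shuffle (fun s t => c * g s t + h s t) a b z = c * shuffle g a b z + shuffle h a b z.
Proof.
elim: z g h a b => [|[a' b'] z IHz] g h a b //=.
case: (eqVneq b' b) => [_|bb]; case: (eqVneq a' a) => [_|aa]; try by rewrite mulr0 addr0.
  exact: IHz.
by rewrite -IHz; apply: eq_shuffle => s t _ _; rewrite mulrDr mulrCA.
Qed.

Lemma shuffle0 g a b z :
  (forall s t, nrep a s -> nrep b t -> g s t = 0) -> shuffle g a b z = 0.
Proof.
move=> g0; rewrite (@eq_shuffle _ (fun s t => -1 * g s t + g s t)).
  by rewrite shuffleZD mulN1r addNr.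
by move=> s t rs rt; rewrite g0 // mulr0 addr0.
Qed.

Lemma shuffle_sum (I : finType) (g : I -> seq X -> seq Y -> R) a b z :
  shuffle (fun s t => \sum_i g i s t) a b z = \sum_i shuffle (g i) a b z.
Proof.
elim: (index_enum I) => [|i r IHr].
  by rewrite big_nil shuffle0 // => s t _ _; rewrite big_nil.
rewrite big_cons -IHr -[X in X + _]mul1r -shuffleZD.
by apply: eq_shuffle => s t _ _; rewrite big_cons mul1r.
Qed.

Lemma sum_step (a : X) (b : Y) (H : X -> R) (K : Y -> R) :
  \sum_(v : X * Y) (if v.2 == b then if v.1 == a then 0 else H v.1
                    else if v.1 == a then K v.2 else 0) =
  \sum_(a' | a' != a) H a' + \sum_(b' | b' != b) K b'.
Proof.
pose F x y := if y == b then if x == a then 0 else H x else if x == a then K y else 0.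
rewrite -(pair_bigA _ (fun x y => F x y)) (bigD1 a) //= addrC; congr (_ + _).
  apply: eq_bigr => x xa; rewrite (bigD1 b) //= big1 /F ?eqxx (negbTE xa) ?addr0 //.
  by move=> y /negbTE->.
rewrite (bigD1 b) //= {1}/F !eqxx add0r.
by apply: eq_bigr => y /negbTE yb; rewrite /F yb eqxx.
Qed.

Definition from_reg (a : X) (b : Y) g :=
  forall s t, ~~ (nrep a s && nrep b t) -> g s t = 0.

Lemma from_reg_hor a b a' g : from_reg a b g -> a' != a ->
  from_reg a' b (fun s t => g (a' :: s) t).
Proof. by move=> rg aa s t H; apply: rg; rewrite /= eq_sym aa. Qed.

Lemma from_reg_ver a b b' g : from_reg a b g -> b' != b ->
  from_reg a b' (fun s t => (-1) ^+ size s * g s (b' :: t)).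
Proof. by move=> rg bb s t H; rewrite rg ?mulr0 //= eq_sym bb. Qed.

(** Boundary of the double chain g with the first vertices a and b kept:
    insertions happen strictly after them, so that size s is the degree in the
    first variable of the path a :: s. *)
Definition tdiff g s t : R := ins (g^~ t) s + (-1) ^+ size s * ins (g s) t.

(** The vanishing of g on irregular paths allows both sums to run
    over all vertices, including a and b themselves. *)
Lemma sum_shuffle_cons a b g (z : seq (X * Y)) :
  from_reg a b g ->
  \sum_v shuffle g a b (v :: z) =
  \sum_a' shuffle (fun s t => g (a' :: s) t) a' b z +
  \sum_b' shuffle (fun s t => (-1) ^+ size s * g s (b' :: t)) a b' z.
Proof.
move=> rg; set H := fun a' => shuffle (fun s t => g (a' :: s) t) a' b z.
set K := fun b' => shuffle (fun s t => (-1) ^+ size s * g s (b' :: t)) a b' z.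
rewrite [RHS](_ : _ = \sum_(a' | a' != a) H a' + \sum_(b' | b' != b) K b').
  by rewrite -sum_step; apply: eq_bigr => -[].
congr (_ + _).
  rewrite (bigD1 a) //= shuffle0 ?add0r // => s t rs rt.
  by rewrite rg //= eqxx.
rewrite (bigD1 b) //= shuffle0 ?add0r // => s t rs rt.
by rewrite rg ?mulr0 //= eqxx andbF.
Qed.

(** Leibniz rule for insertions after the starting vertex. Induction along the
    staircase: inserting a vertex in a horizontal (vertical) step must extend the
    first (second) projection, and in a diagonal step the two possible insertions
    complete it to the two staircases around one square, whose signs differ. *)
Lemma ins_shuffle g a b z : from_reg a b g -> nrep (a, b) z ->
  ins (shuffle g a b) z = shuffle (tdiff g) a b z.
Proof.
elim: z g a b => [|[a' b'] z IHz] g a b rg.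
  move=> _; have -> : ins (shuffle g a b) [::] = \sum_v shuffle g a b [:: v] by [].
  rewrite sum_shuffle_cons //= /tdiff /= mul1r.
  by congr (_ + _); apply: eq_bigr => ? _; rewrite mul1r.
rewrite ins_cons (sum_shuffle_cons _ rg) /= => /andP[+ rz].
case: (eqVneq b' b) rz => [->|bb] rz; case: (eqVneq a' a) rz => [->|aa] rz; rewrite ?eqxx // => _.
- (* The terms a1 = a and a1 = a' vanish by regularity. *)
  have rg' := from_reg_hor rg aa.
  rewrite [X in _ + X - _]big1 ?addr0 => [|b1 _]; last first.
    case: (eqVneq b b1) => // <-; rewrite shuffle0 // => s t rs rt.
    by rewrite rg ?mulr0 //= eqxx andbF.
  rewrite IHz //.
  rewrite (eq_bigr (fun a1 => shuffle (fun s t => g [:: a1, a' & s] t) a' b z)); last first.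
    move=> a1 _; case: (eqVneq a' a1) => // <-; rewrite shuffle0 // => s t _ _.
    by rewrite rg //= eqxx andbF.
  rewrite -shuffle_sum addrC -[- shuffle _ _ _ _]mulN1r -shuffleZD.
  by apply: eq_shuffle => s t _ _; rewrite /tdiff /= exprS; ring.
- (* The sign of the vertical step squares to 1 when a second one follows. *)
  have rg' := from_reg_ver rg bb.
  rewrite [X in X + _ - _]big1 ?add0r => [|a1 _]; last first.
    case: (eqVneq a a1) => // <-; rewrite shuffle0 // => s t _ _.
    by rewrite rg ?mulr0 //= eqxx.
  rewrite IHz //.
  rewrite (eq_bigr (fun b1 => shuffle (fun s t => g s [:: b1, b' & t]) a b' z)); last first.
    move=> b1 _; case: (eqVneq b' b1) => [<-|b1b].
      rewrite shuffle0 // => s t _ _.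
      by rewrite rg //= eqxx !andbF.
    by apply: eq_shuffle => s t _ _; rewrite mulrA -exprMn mulrNN mulr1 expr1n mul1r.
  rewrite -shuffle_sum addrC -[- shuffle _ _ _ _]mulN1r -shuffleZD.
  apply: eq_shuffle => s t _ _; rewrite /tdiff /= insZ.
  rewrite (eq_ins (f2 := fun s0 => (-1) ^+ (size s).+1 * g s0 (b' :: t))); last first.
    by move=> s0 ->.
  have ee : (-1) ^+ size s * (-1) ^+ size s = 1 :> R.
    by rewrite -exprMn mulrNN mulr1 expr1n.
  by rewrite insZ exprS; ring: ee.
- (* Two terms remain, through (a', b) and through (a, b'). *)
  rewrite ins0 ?subr0 //.
  rewrite -!big_mkcond !(big_pred1 a') ?(big_pred1 b'); try by move=> ?; rewrite eq_sym.
  rewrite -[X in X + _]mul1r -shuffleZD shuffle0 // => s t _ _.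
  by rewrite exprS; ring.
Qed.

(** Staircases over paths of e1 and e2 are paths of e. This serves both for
    regular paths and for allowed paths. *)
Lemma shuffle_supp (e1 : rel X) (e2 : rel Y) (e : rel (X * Y)) g a b z :
  (forall x x' y, e (x, y) (x', y) = e1 x x') ->
  (forall x y y', e (x, y) (x, y') = e2 y y') ->
  (forall s t, ~~ (path e1 a s && path e2 b t) -> g s t = 0) ->
  ~~ path e (a, b) z -> shuffle g a b z = 0.
Proof.
move=> eh ev; elim: z g a b => [|[a' b'] z IHz] g a b sg //=.
case: (eqVneq b' b) => [->|bb]; case: (eqVneq a' a) => [->|aa] //.
  rewrite eh; case eaa: (e1 a a') => /=; last first.
    by move=> _; apply: shuffle0 => s t _ _; rewrite sg //= eaa.
  by apply: IHz => s t H; rewrite sg //= eaa.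
rewrite ev; case ebb: (e2 b b') => /=; last first.
  by move=> _; apply: shuffle0 => s t _ _; rewrite sg ?mulr0 //= ebb andbF.
by apply: IHz => s t H; rewrite sg ?mulr0 //= ebb.
Qed.

Lemma shuffle_size p q g a b z :
  (forall s t, ~~ ((size s == p) && (size t == q)) -> g s t = 0) ->
  size z != (p + q)%N -> shuffle g a b z = 0.
Proof.
elim: z p q g a b => [|[a' b'] z IHz] p q g a b sg /=.
  by move=> pq; rewrite sg //; case: p q pq {sg} => [|p] [].
move=> sz; case: ifP => _; case: ifP => _ //.
  case: p sg sz => [|p] sg sz; first by rewrite shuffle0 // => s t _ _; rewrite sg.
  by apply: (IHz p q) => // s t H; rewrite sg.
case: q sg sz => [|q] sg sz.
  by rewrite shuffle0 // => s t _ _; rewrite sg ?mulr0 // andbF.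
by apply: (IHz p q) => [s t H|]; [rewrite sg ?mulr0|rewrite addnS eqSS in sz].
Qed.

(** The coefficient at z of the cross product of a double chain c. *)
Definition xprod (c : seq X -> seq Y -> R) z : R :=
  if z is (a, b) :: z' then shuffle (fun s t => c (a :: s) (b :: t)) a b z' else 0.

Definition reg2 (c : seq X -> seq Y -> R) := forall s t,
  ~~ (sorted (fun i j => i != j) s && sorted (fun i j => i != j) t) -> c s t = 0.

(** Boundary of a double chain, with the sign given by the degree (size s).-1 of
    the first path. *)
Definition tbd (c : seq X -> seq Y -> R) s t : R :=
  ins (c^~ t) s + (-1) ^+ (size s).-1 * ins (c s) t.

(** Leibniz rule. Insertions at the very front extend either
    projection; the others are covered by [ins_shuffle]. *)
Lemma ins_xprod c z : reg2 c -> z != [::] -> sorted (fun i j => i != j) z ->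
  ins (xprod c) z = xprod (tbd c) z.
Proof.
case: z => [//|[a b] z] rc _ rz; rewrite ins_cons /=.
have rg : from_reg a b (fun s t => c (a :: s) (b :: t)).
  by move=> s t H; apply: rc.
rewrite ins_shuffle //.
pose H a1 := shuffle (fun s t => c (a1 :: a :: s) (b :: t)) a b z.
pose K b1 := shuffle (fun s t => (-1) ^+ size s * c (a :: s) (b1 :: b :: t)) a b z.
rewrite (eq_bigr (fun v => if v.2 == b then if v.1 == a then 0 else H v.1
                    else if v.1 == a then K v.2 else 0)); last first.
  move=> [a1 b1] _ /=; rewrite (eq_sym b) (eq_sym a).
  by case: (eqVneq b1 b) => [eb|_]; case: (eqVneq a1 a) => [ea|_]; rewrite ?eb ?ea.
rewrite sum_step.
have -> : \sum_(a' | a' != a) H a' = \sum_a' H a'.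
  rewrite [RHS](bigD1 a) //= {2}/H shuffle0 ?add0r // => s t _ _.
  by rewrite rc //= eqxx.
have -> : \sum_(b' | b' != b) K b' = \sum_b' K b'.
  rewrite [RHS](bigD1 b) //= {2}/K shuffle0 ?add0r // => s t _ _.
  by rewrite rc ?mulr0 //= eqxx andbF.
rewrite /H /K -!shuffle_sum addrC -[- shuffle _ _ _ _]mulN1r.
rewrite -[X in _ + (_ + X)]mul1r [X in _ + X]addrC -shuffleZD -shuffleZD.
apply: eq_shuffle => s t _ _; rewrite /tdiff /tbd /= -mulr_sumr; ring.
Qed.

(** The pairing of two cross products counts every pair of paths once for each
    of its staircases; splitting by the first step of the staircase is Pascal's
    rule. The signs cancel because both factors carry the same one. *)
Lemma sumseq_shuffle n p q g h a b : from_reg a b g ->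
  (forall s t, ~~ ((size s == p) && (size t == q)) -> g s t = 0) ->
  sumseq n (fun z => shuffle g a b z * shuffle h a b z) =
  if (p + q == n)%N then
    'C(n, p)%:R * sumseq p (fun s => sumseq q (fun t => g s t * h s t)) else 0.
Proof.
elim: n p q g h a b => [|n IHn] p q g h a b rg sg /=.
  case: eqP => pq; last by rewrite sg ?mul0r //=; lia.
  have [-> ->] : p = 0%N /\ q = 0%N by lia.
  by rewrite /= bin0 mul1r.
pose H a' := sumseq n (fun z => shuffle (fun s t => g (a' :: s) t) a' b z *
                               shuffle (fun s t => h (a' :: s) t) a' b z).
pose K b' := sumseq n (fun z =>
  shuffle (fun s t => (-1) ^+ size s * g s (b' :: t)) a b' z *
  shuffle (fun s t => (-1) ^+ size s * h s (b' :: t)) a b' z).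
rewrite (eq_bigr (fun v => if v.2 == b then if v.1 == a then 0 else H v.1
                    else if v.1 == a then K v.2 else 0)); last first.
  move=> [a1 b1] _ /=; case: (eqVneq b1 b) => [eb|_]; case: (eqVneq a1 a) => [ea|_];
    rewrite ?eb ?ea //.
    by rewrite sumseq0 // => z _; exact: mul0r.
  by rewrite sumseq0 // => z _; exact: mul0r.
have -> := sum_step a b H K.
pose S := sumseq p (fun s => sumseq q (fun t => g s t * h s t)).
have -> : \sum_(a' | a' != a) H a' =
    if (p + q == n.+1)%N then (if p is p'.+1 then 'C(n, p')%:R else 0) * S else 0.
  case: p sg @S => [|p'] sg S.
    rewrite mul0r if_same big1 // => a' _.
    by rewrite /H sumseq0 // => z _; rewrite shuffle0 ?mul0r // => s t _ _; rewrite sg.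
  under eq_bigr => a' aa.
    rewrite /H (IHn p' q) //; [|exact: (from_reg_hor rg aa)|by move=> s t st; apply: sg].
    over.
  rewrite addSn eqSS; case: ifP => _; last by rewrite big1.
  rewrite -mulr_sumr; congr (_ * _).
  rewrite /S /= [RHS](bigD1 a) //= sumseq0 ?add0r // => s _.
  by rewrite sumseq0 // => t _; rewrite rg ?mul0r //= eqxx.
have -> : \sum_(b' | b' != b) K b' =
    if (p + q == n.+1)%N then (if q is q'.+1 then 'C(n, p)%:R else 0) * S else 0.
  case: q sg @S => [|q'] sg S.
    rewrite mul0r if_same big1 // => b' _.
    rewrite /K sumseq0 // => z _; rewrite shuffle0 ?mul0r // => s t _ _.
    by rewrite sg ?mulr0 // andbF.
  under eq_bigr => b' bb.
    rewrite /K (IHn p q') //; [|exact: (from_reg_ver rg bb)|]; last first.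
      by move=> s t st; rewrite sg ?mulr0.
    over.
  rewrite addnS eqSS; case: ifP => _; last by rewrite big1.
  rewrite -mulr_sumr; congr (_ * _).
  rewrite /S -sumseq_sum; apply: eq_sumseq => s _ /=.
  rewrite [RHS](bigD1 b) //= sumseq0 ?add0r => [|t _]; last first.
    by rewrite rg ?mul0r //= eqxx andbF.
  apply: eq_bigr => b' _; apply: eq_sumseq => t _.
  have ee : (-1) ^+ size s * (-1) ^+ size s = 1 :> R.
    by rewrite -exprMn mulrNN mulr1 expr1n.
  by ring: ee.
case: eqP => pq; last by rewrite addr0.
rewrite -mulrDl; congr (_ * _).
(* Pascal's rule; on the edges p = 0 or q = 0 only one kind of first step exists. *)
case: p q pq {sg S} => [|p] [|q] pq //.
- by rewrite add0r !bin0.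
- have -> : n = p by lia.
  by rewrite addr0 !binn.
- by rewrite binS natrD addrC.
Qed.

Lemma sumseq_xprod n p q c d : reg2 c ->
  (forall s t, ~~ ((size s == p.+1) && (size t == q.+1)) -> c s t = 0) ->
  sumseq n.+1 (fun z => xprod c z * xprod d z) =
  if (p + q == n)%N then
    'C(n, p)%:R * sumseq p.+1 (fun s => sumseq q.+1 (fun t => c s t * d s t)) else 0.
Proof.
move=> rc sc /=.
rewrite (eq_bigr (fun v => if (p + q == n)%N then 'C(n, p)%:R * sumseq p (fun s =>
    sumseq q (fun t => c (v.1 :: s) (v.2 :: t) * d (v.1 :: s) (v.2 :: t))) else 0)).
  2:{ move=> [a b] _ /=; apply: sumseq_shuffle; first by move=> s t H; apply: rc.
      by move=> s t H; apply: sc. }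
rewrite /=; case: ifP => _; last by rewrite big1.
rewrite -mulr_sumr; congr (_ * _).
rewrite -(pair_bigA _ (fun a b => sumseq p (fun s => sumseq q (fun t =>
   c (a :: s) (b :: t) * d (a :: s) (b :: t))))) /=.
by apply: eq_bigr => a _; rewrite sumseq_sum.
Qed.

(** The staircase with all horizontal steps first: no area lies under it, so it
    carries the sign +1. *)
Definition stair (a : X) (b : Y) s t : seq (X * Y) :=
  [seq (x, b) | x <- s] ++ [seq (last a s, y) | y <- t].

Lemma size_stair a b s t : size (stair a b s t) = (size s + size t)%N.
Proof. by rewrite size_cat !size_map. Qed.

Lemma path_stair (e1 : rel X) (e2 : rel Y) (e : rel (X * Y)) a b s t :
  (forall x x' y, e (x, y) (x', y) = e1 x x') ->
  (forall x y y', e (x, y) (x, y') = e2 y y') ->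
  path e (a, b) (stair a b s t) = path e1 a s && path e2 b t.
Proof.
move=> eh ev; elim: s a => [|x s IHs] a /=; last by rewrite eh IHs andbA.
by rewrite /stair /=; elim: t b => //= y t IHt b; rewrite ev IHt.
Qed.

Lemma shuffle_stair g a b s t : nrep a s -> nrep b t ->
  shuffle g a b (stair a b s t) = g s t.
Proof.
elim: s g a => [|x s IHs] g a /=; last first.
  by case/andP=> ax rs rt; rewrite eqxx eq_sym (negbTE ax) IHs.
move=> _; rewrite /stair /=; elim: t g b => //= y t IHt g b /andP[yb rt].
by rewrite eq_sym (negbTE yb) eqxx IHt // mul1r.
Qed.

(** Necessary conditions on the coefficients of a cross product: they
    vanish unless every step changes exactly one coordinate, and change sign when
    a corner is flipped across its square. Lemma [stairlikeE] shows that
    they are sufficient. *)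
Definition stairlike (w : seq (X * Y) -> R) :=
  (forall pre post (a : X) (b : Y) a' b', (a' == a) = (b' == b) ->
    w (pre ++ [:: (a, b), (a', b') & post]) = 0) /\
  (forall pre post (a : X) (b : Y) a' b', a' != a -> b' != b ->
    w (pre ++ [:: (a, b), (a', b), (a', b') & post]) =
    - w (pre ++ [:: (a, b), (a, b'), (a', b') & post])).

Lemma stairlike_cons w v : stairlike w -> stairlike (fun z => w (v :: z)).
Proof. by case=> w1 w2; split=> pre *; [apply: (w1 (v :: pre))|apply: (w2 (v :: pre))]. Qed.

(** Moving a vertical step past the horizontal steps s flips size s corners. *)
Lemma stairlike_swap (w : seq (X * Y) -> R) a b b' s t : stairlike w -> b' != b -> nrep a s ->
  w [:: (a, b), (a, b') & stair a b' s t] =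
  (-1) ^+ size s * w ((a, b) :: stair a b s (b' :: t)).
Proof.
move=> + bb; elim: s w a => [|x s IHs] w a sw /=; first by rewrite mul1r.
case/andP=> ax rs; rewrite exprS mulN1r mulNr.
rewrite -(IHs (fun z => w ((a, b) :: z))) //; last exact: stairlike_cons.
by have := sw.2 [::] (stair x b' s t) a b x b'; rewrite /= => -> //; rewrite ?opprK // eq_sym.
Qed.

(** By corner flips any staircase can be brought to the one with horizontal steps
    first, so the coefficients on these determine w. *)
Lemma stairlikeE w a b z : stairlike w ->
  w ((a, b) :: z) = shuffle (fun s t => w ((a, b) :: stair a b s t)) a b z.
Proof.
elim: z w a b => [|[a' b'] z IHz] w a b sw //=.
have sw' := stairlike_cons (a, b) sw.
have w0 := sw.1 [::] z a b a' b'.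
case: (eqVneq b' b) w0 => [->|bb]; case: (eqVneq a' a) => [->|aa] w0.
- exact: w0.
- exact: IHz sw'.
- rewrite (IHz _ _ _ sw'); apply: eq_shuffle => s t rs rt.
  exact: stairlike_swap.
- exact: w0.
Qed.

(** A path with a diagonal step is a face of only two paths with nonzero
    coefficient: insertion elsewhere leaves the diagonal step, and insertion
    there must go through one of the two other corners of the square. *)
Lemma ins_corner (w : seq (X * Y) -> R) pre post a b a' b' :
  (forall pre post (a : X) (b : Y) a' b', (a' == a) = (b' == b) ->
    w (pre ++ [:: (a, b), (a', b') & post]) = 0) ->
  a' != a -> b' != b ->
  ins w (pre ++ [:: (a, b), (a', b') & post]) =
  (-1) ^+ (size pre).+1 * (w (pre ++ [:: (a, b), (a', b), (a', b') & post]) +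
                           w (pre ++ [:: (a, b), (a, b'), (a', b') & post])).
Proof.
move=> + aa bb; elim: pre w => [|v pre IHpre] w w0; last first.
  rewrite cat_cons ins_cons big1 ?sub0r => [|u _]; last first.
    by rewrite -[LHS]/(w ([:: u, v & pre] ++ _)) w0 // (negbTE aa) (negbTE bb).
  rewrite IHpre => [|pre' *]; last exact: (w0 (v :: pre')).
  by rewrite [in RHS]exprS mulN1r mulNr.
rewrite !cat0s 2!ins_cons big1 ?sub0r => [|u _]; last first.
  by rewrite -[LHS]/(w ([:: u] ++ _)) w0 // (negbTE aa) (negbTE bb).
rewrite ins0 ?subr0 => [|t _]; last first.
  by rewrite -[LHS]/(w ([::] ++ _)) w0 // (negbTE aa) (negbTE bb).
rewrite expr1 mulN1r; congr (- _).
rewrite (bigD1 (a', b)) //= (bigD1 (a, b')) /=; last first.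
  by rewrite xpair_eqE negb_and eq_sym aa.
rewrite big1 ?addr0 // => -[x y]; rewrite !xpair_eqE => /andP[h1 h2].
case exa : ((x == a) == (y == b)).
  exact: (w0 [::] _ a b x y (eqP exa)).
apply: (w0 [:: (a, b)] post x y a' b').
move: h1 h2 exa; rewrite (eq_sym a') (eq_sym b').
case: (eqVneq x a) => [->|xa]; case: (eqVneq y b) => [->|yb] //=.
  by rewrite (eq_sym a) (negbTE aa) => _ /negbTE->.
by rewrite (eq_sym b) (negbTE bb) ?andbT => /negbTE->.
Qed.

End Shuffle.

(** * Coefficients of chains *)

(** Insertion is adjoint to deletion: [ins] of an indicator function collects
    the faces of t that are equal to s. *)
Lemma ins_indic (R : comNzRingType) (V : finType) (s t : seq V) :
  size t = (size s).+1 ->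
  ins (fun s' => (t == s')%:R) s =
  \sum_(k < size t) (-1) ^+ k * (take k t ++ drop k.+1 t == s)%:R :> R.
Proof.
elim: s t => [|a s IHs] [|c t] //= [szt].
  rewrite (size0nil szt) big_ord_recl big_ord0 /= mul1r addr0.
  rewrite (bigD1 c) //= eqxx big1 ?addr0 // => v vc.
  by rewrite eqseq_cons eq_sym (negbTE vc).
rewrite big_ord_recl /= mul1r drop0 (bigD1 c) //= big1 => [|v vc]; last first.
  by rewrite eqseq_cons eq_sym (negbTE vc).
rewrite eqseq_cons eqxx /= addr0; congr (_ + _).
rewrite (eq_ins (f2 := fun s' => (c == a)%:R * (t == s')%:R)) => [|s' _]; last first.
  by rewrite eqseq_cons -natrM mulnb.
rewrite insZ IHs // mulr_sumr -sumrN; apply: eq_bigr => k _.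
by rewrite /= eqseq_cons exprS -mulnb natrM; ring.
Qed.

Lemma sumseq_indic (R : comNzRingType) (V : finType) n (t : seq V) (f : seq V -> R) :
  size t = n -> sumseq n (fun s => (t == s)%:R * f s) = f t.
Proof.
elim: n t f => [|n IHn] [|c t] f //= => [_|[szt]]; first by rewrite mul1r.
rewrite (bigD1 c) //= big1 ?addr0 => [|v vc]; last first.
  by rewrite sumseq0 // => s _; rewrite eqseq_cons eq_sym (negbTE vc) mul0r.
rewrite -(IHn t (fun s => f (c :: s))) //.
by apply: eq_sumseq => s _; rewrite eqseq_cons eqxx.
Qed.

Section Coefficients.
Variables (R : realType) (G : digraph).
Implicit Types (p : nat) (s : seq G).

(** The coefficients of a chain as a function on all sequences, 0 outside the
    regular paths with p.+1 vertices. Since no degree occurs in the type of this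
    function, the identities of the previous part apply to it without casts
    between chain (p.+1 + q) and chain (p + q).+1. *)
Definition pcoef p (u : chain R G p) s : R :=
  \sum_(t : rpath G p) u t * (val (val t) == s)%:R.

Definition chain_of p (f : seq G -> R) : chain R G p := [ffun t => f (val (val t))].

Lemma pcoefE p (u : chain R G p) (t : rpath G p) : pcoef u (val (val t)) = u t.
Proof.
rewrite /pcoef (bigD1 t) //= eqxx mulr1 big1 ?addr0 // => t' tt'.
case: eqP => [/val_inj/val_inj e|_]; last exact: mulr0.
by rewrite e eqxx in tt'.
Qed.

Lemma pcoef_supp p (u : chain R G p) s :
  ~~ ((size s == p.+1) && regular s) -> pcoef u s = 0.
Proof.
move=> ns; apply: big1 => t _; case: eqP => [e|_]; rewrite ?mulr0 //.
by rewrite -e size_tuple eqxx (valP t) in ns.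
Qed.

Lemma pcoef_size p (u : chain R G p) s : size s != p.+1 -> pcoef u s = 0.
Proof. by move=> /negbTE ns; rewrite pcoef_supp ?ns. Qed.

Lemma pcoef_nreg p (u : chain R G p) s : ~~ regular s -> pcoef u s = 0.
Proof. by move=> /negbTE ns; rewrite pcoef_supp ?ns ?andbF. Qed.

Lemma rpathP p s : size s = p.+1 -> regular s -> exists t : rpath G p, val (val t) = s.
Proof. by move=> /eqP sz rs; exists (Sub (Tuple sz) rs). Qed.

Lemma pcoef_chain_of p f s : size s = p.+1 -> regular s -> pcoef (chain_of p f) s = f s.
Proof. by move=> sz rs; have [t <-] := rpathP sz rs; rewrite pcoefE ffunE. Qed.

Lemma pcoefP p (u v : chain R G p) :
  (forall s, size s = p.+1 -> regular s -> pcoef u s = pcoef v s) -> u = v.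
Proof. by move=> H; apply/ffunP=> t; rewrite -!pcoefE H ?size_tuple ?(valP t). Qed.

Lemma pcoefZD p a (u v : chain R G p) s : pcoef (a *: u + v) s = a * pcoef u s + pcoef v s.
Proof.
rewrite /pcoef mulr_sumr -big_split; apply: eq_bigr => t _.
by rewrite !ffunE /= mulrDl mulrA.
Qed.

Lemma pcoef0 p s : pcoef (0 : chain R G p) s = 0.
Proof. by apply: big1 => t _; rewrite ffunE mul0r. Qed.

Lemma pcoefZ p a (u : chain R G p) s : pcoef (a *: u) s = a * pcoef u s.
Proof. by rewrite -[a *: u]addr0 pcoefZD pcoef0 addr0. Qed.

Lemma pcoefD p (u v : chain R G p) s : pcoef (u + v) s = pcoef u s + pcoef v s.
Proof. by rewrite -[u]scale1r pcoefZD mul1r scale1r. Qed.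

Lemma pcoef_sum p (I : finType) (F : I -> chain R G p) s :
  pcoef (\sum_i F i) s = \sum_i pcoef (F i) s.
Proof.
by apply: (big_morph (fun u : chain R G p => pcoef u s)); [move=> u v; apply: pcoefD|apply: pcoef0].
Qed.

Lemma pcoef_elem p s s' : size s = p.+1 -> regular s ->
  pcoef (elem R p s') s = (s' == s)%:R.
Proof.
by move=> sz rs; have [t <-] := rpathP sz rs; rewrite pcoefE ffunE eq_sym.
Qed.

Lemma ins_pcoef_sum p (u : chain R G p) s :
  ins (pcoef u) s = \sum_(t : rpath G p) u t * ins (fun s' => (val (val t) == s')%:R) s.
Proof.
rewrite /pcoef; elim: (index_enum _) => [|t r IHr].
  by rewrite big_nil ins0 // => s' _; rewrite big_nil.
rewrite big_cons -IHr -insZ.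
have insD (f g : seq G -> R) : ins (fun s' => f s' + g s') s = ins f s + ins g s.
  elim: s f g {IHr} => [|a s IHs] f g /=; first by rewrite big_split.
  by rewrite big_split IHs /=; ring.
by rewrite -insD; apply: eq_ins => s' _; rewrite big_cons.
Qed.

Lemma pcoef_boundary p (u : chain R G p) s : s != [::] -> regular s ->
  pcoef (boundary R G p u) s = ins (pcoef u) s.
Proof.
move=> s0 rs; have [sz|sz] := eqVneq (size s) p; last first.
  rewrite ins0 => [|s' szs']; last by rewrite pcoef_size // szs' eqSS.
  case: p u sz => [|p] u sz; first by rewrite boundary0 lfunE /= pcoef0.
  by rewrite pcoef_size.
case: p u sz => [|p] u sz; first by rewrite (size0nil sz) in s0.
rewrite ins_pcoef_sum {1}(chainE u) linear_sum pcoef_sum; apply: eq_bigr => t _.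
rewrite linearZ /= pcoefZ bd_elemE ?size_tuple // /bd_elem pcoef_sum.
congr (_ * _); rewrite ins_indic ?size_tuple ?sz //.
by apply: eq_bigr => k _; rewrite pcoefZ pcoef_elem.
Qed.

(** The inner product in degree p, for functions on sequences. It also makes
    sense for coefficients of chains of other degrees and then gives 0, as it
    should in [inner_cross]. *)
Definition pairing p (f g : seq G -> R) : R :=
  (p`!%:R)^-1 * sumseq p.+1 (fun s => f s * g s).

Lemma sumseq_pcoef p (u : chain R G p) f :
  sumseq p.+1 (fun s => pcoef u s * f s) = \sum_(t : rpath G p) u t * f (val (val t)).
Proof.
rewrite -(eq_sumseq (f1 := fun s => \sum_(t : rpath G p) u t * ((val (val t) == s)%:R * f s))).
  rewrite sumseq_sum; apply: eq_bigr => t _.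
  by rewrite sumseqZ sumseq_indic ?size_tuple.
by move=> s _; rewrite /pcoef mulr_suml; apply: eq_bigr => t _; rewrite mulrA.
Qed.

Lemma innerE p (u v : chain R G p) : inner u v = pairing p (pcoef u) (pcoef v).
Proof. by rewrite /pairing sumseq_pcoef; congr (_ * _); apply: eq_bigr => t _; rewrite pcoefE. Qed.

Lemma A_P p (u : chain R G p) :
  reflect (forall s, ~~ allowed s -> pcoef u s = 0) (u \in A_ R G p).
Proof.
apply: (iffP idP) => [/memv_sumP[w wt ->] s ns|H].
  elim/big_ind: _ => [|v1 v2 h1 h2|t at_]; first exact: pcoef0.
    by rewrite pcoefD h1 h2 addr0.
  have /vlineP[k ->] := wt t at_.
  rewrite pcoefZ; have [sz|sz] := eqVneq (size s) p.+1; last by rewrite pcoef_size ?mulr0.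
  have [rs|rs] := boolP (regular s); last by rewrite pcoef_nreg ?mulr0.
  rewrite pcoef_elem //; case: eqP => [e|]; rewrite ?mulr0 //.
  by rewrite -e at_ in ns.
rewrite (chainE u) (bigID (fun t : rpath G p => allowed (val (val t)))) /=.
rewrite [X in _ + X]big1 ?addr0 => [|t nt]; last by rewrite -pcoefE H ?scale0r.
by apply: memv_sumr => t at_; rewrite memvZ ?memv_line.
Qed.

(** The condition on the boundary holds trivially at the empty
    sequence and at irregular ones, where the coefficient of a boundary is 0 but
    [ins] may be nonzero. *)
Lemma OmegaP p (u : chain R G p) :
  reflect ((forall s, ~~ allowed s -> pcoef u s = 0) /\
           (forall s, s != [::] -> regular s -> ~~ allowed s -> ins (pcoef u) s = 0))
          (u \in Omega R G p).
Proof.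
rewrite memv_cap -memv_preim; apply: (iffP andP) => -[h1 h2].
  split; first exact/A_P.
  by move=> s s0 rs ns; rewrite -pcoef_boundary //; move/A_P: h2 => ->.
split; first exact/A_P.
apply/A_P => s ns; have [sz|sz] := eqVneq s [::]; first by rewrite sz pcoef_size.
have [rs|rs] := boolP (regular s); last by rewrite pcoef_nreg.
by rewrite pcoef_boundary // h2.
Qed.

Lemma allowed_regular s : allowed s -> regular s.
Proof.
apply: sub_sorted => i j; apply: contraTneq => ->; by rewrite arrow_irr.
Qed.

End Coefficients.

(** * Cross products of chains *)

Section Cross.
Variables (R : realType) (X Y : digraph).
Local Notation Z := (box X Y).

Definition tensor (f : seq X -> R) (g : seq Y -> R) : seq X -> seq Y -> R :=
  fun s t => f s * g t.

Lemma box_hor (x x' : X) (y : Y) : @arrow Z (x, y) (x', y) = arrow x x'.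
Proof. by rewrite /= /box_arrow /= eqxx andbT arrow_irr andbF. Qed.

Lemma box_ver (x : X) (y y' : Y) : @arrow Z (x, y) (x, y') = arrow y y'.
Proof. by rewrite /= /box_arrow /= eqxx arrow_irr orbF. Qed.

Lemma neq_hor (x x' : X) (y : Y) : ((x, y) != (x', y)) = (x != x').
Proof. by rewrite xpair_eqE eqxx andbT. Qed.

Lemma neq_ver (x : X) (y y' : Y) : ((x, y) != (x, y')) = (y != y').
Proof. by rewrite xpair_eqE eqxx. Qed.

Lemma xprod_allowed (c : seq X -> seq Y -> R) (z : seq Z) :
  (forall s t, ~~ (allowed s && allowed t) -> c s t = 0) ->
  ~~ allowed z -> xprod c z = 0.
Proof.
case: z => [|[a b] z] // sc nz.
apply: (@shuffle_supp _ _ _ (@arrow X) (@arrow Y) (@arrow Z)) nz.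
- exact: box_hor.
- exact: box_ver.
- by move=> s t H; apply: (sc (a :: s) (b :: t) H).
Qed.

Lemma xprod_nreg c (z : seq Z) : reg2 c -> ~~ regular z -> xprod c z = 0 :> R.
Proof.
case: z => [|[a b] z] // sc nz.
apply: (@shuffle_supp _ _ _ (fun i j : X => i != j) (fun i j : Y => i != j)
  (fun i j : X * Y => i != j)) nz.
- exact: neq_hor.
- exact: neq_ver.
- by move=> s t H; apply: (sc (a :: s) (b :: t) H).
Qed.

Lemma eq_xprod c d (z : seq Z) :
  (forall s t, s != [::] -> t != [::] -> regular s -> regular t -> c s t = d s t) ->
  xprod c z = xprod d z :> R.
Proof.
by case: z => [|[a b] z] // H; apply: eq_shuffle => s t rs rt; apply: H.
Qed.

Lemma xprodZD k c d (z : seq Z) :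
  xprod (fun s t => k * c s t + d s t) z = k * xprod c z + xprod d z :> R.
Proof. by case: z => [|[a b] z]; rewrite ?mulr0 ?addr0 // /xprod shuffleZD. Qed.

Lemma tensor_reg p q (u : chain R X p) (v : chain R Y q) : reg2 (tensor (pcoef u) (pcoef v)).
Proof.
by move=> s t; rewrite negb_and /tensor => /orP[/pcoef_nreg->|/pcoef_nreg->]; rewrite ?mul0r ?mulr0.
Qed.

Lemma tensor_size p q (u : chain R X p) (v : chain R Y q) s t :
  ~~ ((size s == p.+1) && (size t == q.+1)) -> tensor (pcoef u) (pcoef v) s t = 0.
Proof.
by rewrite negb_and /tensor => /orP[/pcoef_size->|/pcoef_size->]; rewrite ?mul0r ?mulr0.
Qed.

(** The degree r of the cross product is a free parameter, meaningful for
    r = p + q, so that products of different bidegrees can be added. *)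
Definition cross r p q (u : chain R X p) (v : chain R Y q) : chain R Z r :=
  @chain_of R Z r (xprod (tensor (pcoef u) (pcoef v))).

Lemma pcoef_cross r p q (u : chain R X p) (v : chain R Y q) z : r = (p + q)%N ->
  pcoef (cross r u v) z = xprod (tensor (pcoef u) (pcoef v)) z.
Proof.
move=> rpq; have [rz|nz] := boolP (regular z); last first.
  rewrite pcoef_nreg // xprod_nreg //; exact: tensor_reg.
have [sz|sz] := eqVneq (size z) r.+1; first by rewrite pcoef_chain_of.
rewrite pcoef_size //; case: z sz {rz} => [|[a b] z] // sz.
rewrite /xprod (@shuffle_size _ _ _ p q) // -?rpq //.
by move=> s t H; apply: tensor_size.
Qed.

Lemma crossDl r p q k (u1 u2 : chain R X p) (v : chain R Y q) :
  cross r (k *: u1 + u2) v = k *: cross r u1 v + cross r u2 v.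
Proof.
apply: pcoefP => z sz rz; rewrite pcoefZD !pcoef_chain_of // -xprodZD.
by apply: eq_xprod => s t _ _ _ _; rewrite /tensor pcoefZD; ring.
Qed.

Lemma crossDr r p q k (u : chain R X p) (v1 v2 : chain R Y q) :
  cross r u (k *: v1 + v2) = k *: cross r u v1 + cross r u v2.
Proof.
apply: pcoefP => z sz rz; rewrite pcoefZD !pcoef_chain_of // -xprodZD.
by apply: eq_xprod => s t _ _ _ _; rewrite /tensor pcoefZD; ring.
Qed.

Lemma cross0l r p q (v : chain R Y q) : cross r (0 : chain R X p) v = 0.
Proof. by have := @crossDl r p q (-1) 0 0 v; rewrite scaler0 addr0 scaleN1r addNr. Qed.

Lemma cross0r r p q (u : chain R X p) : cross r u (0 : chain R Y q) = 0.
Proof. by have := @crossDr r p q (-1) u 0 0; rewrite scaler0 addr0 scaleN1r addNr. Qed.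

Lemma crossZl r p q k (u : chain R X p) (v : chain R Y q) :
  cross r (k *: u) v = k *: cross r u v.
Proof. by rewrite -[k *: u]addr0 crossDl cross0l addr0. Qed.

Lemma crossZr r p q k (u : chain R X p) (v : chain R Y q) :
  cross r u (k *: v) = k *: cross r u v.
Proof. by rewrite -[k *: v]addr0 crossDr cross0r addr0. Qed.

(** For p = 0 the degree of (boundary u) x v is not r.-1, but both sides
    are 0. *)
Lemma pcoef_cross_bdl r p q (u : chain R X p) (v : chain R Y q) z : r = (p + q)%N ->
  pcoef (cross r.-1 (boundary R X p u) v) z =
  xprod (tensor (pcoef (boundary R X p u)) (pcoef v)) z.
Proof.
move=> ->; case: p u => [|p] u; last by rewrite pcoef_cross.
rewrite boundary0 lfunE /= cross0l pcoef0; case: z => [|[a b] z] //.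
by rewrite /xprod shuffle0 // => s t _ _; rewrite /tensor pcoef0 mul0r.
Qed.

Lemma pcoef_cross_bdr r p q (u : chain R X p) (v : chain R Y q) z : r = (p + q)%N ->
  pcoef (cross r.-1 u (boundary R Y q v)) z =
  xprod (tensor (pcoef u) (pcoef (boundary R Y q v))) z.
Proof.
move=> ->; case: q v => [|q] v; last by rewrite pcoef_cross ?addnS.
rewrite boundary0 lfunE /= cross0r pcoef0; case: z => [|[a b] z] //.
by rewrite /xprod shuffle0 // => s t _ _; rewrite /tensor pcoef0 mulr0.
Qed.

Lemma boundary_cross r p q (u : chain R X p) (v : chain R Y q) : r = (p + q)%N ->
  boundary R Z r (cross r u v) =
  cross r.-1 (boundary R X p u) v + (-1) ^+ p *: cross r.-1 u (boundary R Y q v).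
Proof.
move=> rpq; apply: pcoefP => z sz rz.
have z0 : z != [::] by case: z sz {rz}.
rewrite pcoef_boundary // addrC pcoefZD pcoef_cross_bdl // pcoef_cross_bdr //.
rewrite (eq_ins (f2 := xprod (tensor (pcoef u) (pcoef v)))) => [|s _]; last exact: pcoef_cross.
rewrite ins_xprod //; last exact: tensor_reg.
rewrite -xprodZD; apply: eq_xprod => s t s0 t0 rs rt.
rewrite /tbd /tensor !pcoef_boundary // insZ.
rewrite (eq_ins (f2 := fun s0 => pcoef v t * pcoef u s0)) => [|s1 _]; last exact: mulrC.
rewrite insZ; have [ss|ss] := eqVneq (size s) p.+1; first by rewrite ss /=; ring.
by rewrite (pcoef_size u ss) !mul0r !mulr0 addr0 add0r mulrC.
Qed.

Lemma sumseq_tensor p q (f f' : seq X -> R) (g g' : seq Y -> R) :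
  sumseq p (fun s => sumseq q (fun t => tensor f g s t * tensor f' g' s t)) =
  sumseq p (fun s => f s * f' s) * sumseq q (fun t => g t * g' t).
Proof.
rewrite mulrC -sumseqZ; apply: eq_sumseq => s _.
rewrite mulrC -sumseqZ; apply: eq_sumseq => t _.
by rewrite /tensor; ring.
Qed.

(** The weights p! enter here: they turn the number of staircases of a pair of
    paths into the product of the weights of the factors. *)
Lemma inner_cross_gen r p q (u : chain R X p) (v : chain R Y q)
    (w : chain R Z r) (d : seq X -> seq Y -> R) : r = (p + q)%N ->
  (forall z, pcoef w z = xprod d z) ->
  inner (cross r u v) w =
  (p`!%:R)^-1 * (q`!%:R)^-1 *
  sumseq p.+1 (fun s => sumseq q.+1 (fun t => tensor (pcoef u) (pcoef v) s t * d s t)).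
Proof.
move=> rpq wd; rewrite innerE /pairing.
rewrite (eq_sumseq (f2 := fun z => xprod (tensor (pcoef u) (pcoef v)) z * xprod d z)); last first.
  by move=> z _; rewrite pcoef_cross // wd.
rewrite (@sumseq_xprod _ _ _ _ p q) -?rpq ?eqxx; [|exact: tensor_reg|exact: tensor_size].
rewrite mulrA; congr (_ * _).
have := @bin_fact r p; rewrite rpq leq_addr addKn => /(_ isT) <-.
have hp : p`!%:R != 0 :> R by rewrite pnatr_eq0 -lt0n fact_gt0.
have hq : q`!%:R != 0 :> R by rewrite pnatr_eq0 -lt0n fact_gt0.
have hc : 'C(p + q, p)%:R != 0 :> R by rewrite pnatr_eq0 -lt0n bin_gt0 leq_addr.
by rewrite !natrM; field; rewrite hp hq hc.
Qed.

Lemma inner_cross_tensor r p q (u : chain R X p) (v : chain R Y q) (w : chain R Z r) f g :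
  r = (p + q)%N -> (forall z, pcoef w z = xprod (tensor f g) z) ->
  inner (cross r u v) w = pairing p (pcoef u) f * pairing q (pcoef v) g.
Proof.
by move=> rpq wE; rewrite (inner_cross_gen _ _ rpq wE) sumseq_tensor /pairing; ring.
Qed.

Lemma inner_cross r p q p' q' (u : chain R X p) (v : chain R Y q)
    (u' : chain R X p') (v' : chain R Y q') : r = (p + q)%N -> r = (p' + q')%N ->
  inner (cross r u v) (cross r u' v') =
  pairing p (pcoef u) (pcoef u') * pairing q (pcoef v) (pcoef v').
Proof.
by move=> rpq rpq'; apply: inner_cross_tensor => // z; apply: pcoef_cross.
Qed.

Lemma cross_A r p q (u : chain R X p) (v : chain R Y q) : r = (p + q)%N ->
  u \in A_ R X p -> v \in A_ R Y q -> cross r u v \in A_ R Z r.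
Proof.
move=> rpq /A_P Au /A_P Av; apply/A_P => z nz; rewrite pcoef_cross //.
apply: xprod_allowed nz => s t; rewrite negb_and /tensor => /orP[/Au->|/Av->].
  exact: mul0r.
exact: mulr0.
Qed.

Lemma mem_Omega (G : digraph) p (u : chain R G p) :
  (u \in Omega R G p) = (u \in A_ R G p) && (boundary R G p u \in A_ R G p.-1).
Proof. by rewrite memv_cap -memv_preim. Qed.

(** By the Leibniz rule, since each term of it is a cross product of
    allowed chains. *)
Lemma cross_Omega r p q (u : chain R X p) (v : chain R Y q) : r = (p + q)%N ->
  u \in Omega R X p -> v \in Omega R Y q -> cross r u v \in Omega R Z r.
Proof.
move=> rpq; rewrite !mem_Omega => /andP[Au Bu] /andP[Av Bv].
rewrite cross_A //= boundary_cross // memvD ?memvZ //.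
  case: p u rpq Au Bu => [|p] u rpq Au Bu; first by rewrite boundary0 lfunE /= cross0l mem0v.
  by rewrite cross_A // rpq.
case: q v rpq Av Bv => [|q] v rpq Av Bv; first by rewrite boundary0 lfunE /= cross0r mem0v.
by rewrite cross_A // rpq addnS.
Qed.

Lemma sorted_cat_cons (T : Type) (e : rel T) s x t :
  sorted e (s ++ x :: t) = sorted e (rcons s x) && path e x t.
Proof. by case: s => [|y s] //=; rewrite cat_path rcons_path /= andbA. Qed.

(** The coefficient of the boundary of w at a path with a diagonal step is, up to
    sign, the sum of the coefficients at the two staircases that go around the
    square. The path is not allowed, so for w in Omega this sum is 0. *)
Lemma Omega_stairlike r (w : chain R Z r) : w \in Omega R Z r -> stairlike (pcoef w).
Proof.
case/OmegaP=> Aw Bw.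
have w1 pre post (a : X) (b : Y) a' b' : (a' == a) = (b' == b) ->
    pcoef w (pre ++ [:: (a, b), (a', b') & post] : seq Z) = 0.
  move=> ab; rewrite Aw // /allowed sorted_cat_cons.
  suff -> : path (@arrow Z) (a, b) ((a', b') :: post) = false by rewrite andbF.
  rewrite /= /box_arrow /= eq_sym ab (eq_sym b b').
  by case: eqVneq ab => [->|_]; case: eqVneq => [->|_]; rewrite ?arrow_irr ?andbF.
split=> // pre post a b a' b' aa bb; apply/eqP; rewrite -addr_eq0.
pose z := pre ++ [:: (a, b), (a', b') & post].
have az : ~~ allowed (z : seq Z).
  rewrite /allowed sorted_cat_cons /= /box_arrow /= eq_sym (negbTE aa).
  by rewrite eq_sym (negbTE bb) !andbF.
have [rz|nz] := boolP (regular (z : seq Z)).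
  have := Bw z; rewrite /z ins_corner // => H; have := H _ rz az.
  move/(_ ltac:(by case: (pre))) => /eqP.
  by rewrite mulf_eq0 signr_eq0.
have nr c : ~~ regular (pre ++ [:: (a, b), c, (a', b') & post] : seq Z).
  apply: contra nz; rewrite /z /regular !sorted_cat_cons /= => /and4P[-> _ _ ->].
  by rewrite xpair_eqE negb_and eq_sym aa.
by rewrite !pcoef_nreg ?addr0.
Qed.

End Cross.

(** * Surjectivity of the cross product *)

Section Kunneth.
Variables (R : realType) (X Y : digraph).
Local Notation Z := (box X Y).

(** The double chain of which w is the cross product, read off on the staircases
    with horizontal steps first. *)
Definition unstair (w : seq Z -> R) (s : seq X) (t : seq Y) : R :=
  if s is x :: s' then if t is y :: t' then w ((x, y) :: stair x y s' t') else 0 else 0.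

Section Slices.
Variables (r : nat) (w : chain R Z r).
Hypothesis Ow : w \in Omega R Z r.
Local Notation c := (unstair (pcoef w)).

Lemma pcoef_unstair z : pcoef w z = xprod c z.
Proof.
case: z => [|[a b] z]; first by rewrite pcoef_size.
exact: (@stairlikeE R X Y (pcoef w) a b z (Omega_stairlike Ow)).
Qed.

Lemma unstair_allowed s t : ~~ (allowed s && allowed t) -> c s t = 0.
Proof.
case: s t => [|x s] [|y t] //= nst; case/OmegaP: Ow => Aw _; apply: Aw.
apply: contra nst; rewrite /allowed /=.
by rewrite (@path_stair _ _ (@arrow X) (@arrow Y)) //; [exact: box_hor|exact: box_ver].
Qed.

Lemma unstair_reg : reg2 c.
Proof.
move=> s t nst; apply: unstair_allowed; apply: contra nst => /andP[As At].
by apply/andP; split; apply: allowed_regular.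
Qed.

Lemma unstair_size s t : (size s + size t != r.+2)%N -> c s t = 0.
Proof.
case: s t => [|x s] [|y t] //= sz; apply: pcoef_size => /=.
by rewrite size_stair; move: sz; rewrite addSn addnS !eqSS.
Qed.

(** The staircase over s and t is not allowed, so the boundary of w vanishes at
    it; by the Leibniz rule its coefficient there is that of the boundary of
    the double chain. *)
Lemma tbd_unstair s t : s != [::] -> t != [::] -> regular s -> regular t ->
  ~~ (allowed s && allowed t) -> tbd c s t = 0.
Proof.
case: s t => [|x s] [|y t] // _ _ rs rt nst.
pose z := (x, y) :: stair x y s t.
have rz : regular (z : seq Z).
  rewrite /regular /= (@path_stair _ _ (fun i j : X => i != j) (fun i j : Y => i != j)) //.
  - exact/andP.
  - exact: neq_hor.
  - exact: neq_ver.
have nz : ~~ allowed (z : seq Z).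
  rewrite /allowed /= (@path_stair _ _ (@arrow X) (@arrow Y)) //; [exact: box_hor|exact: box_ver].
case/OmegaP: Ow => _ /(_ z isT rz nz).
rewrite (eq_ins (f2 := xprod c)) => [|z' _]; last exact: pcoef_unstair.
rewrite ins_xprod //; last exact: unstair_reg.
by rewrite /z /xprod shuffle_stair.
Qed.

(** When s is not allowed all coefficients c s t' vanish, so the boundary of the
    double chain at (s, t) reduces to the boundary of the slice at s. *)
Lemma unstair_Omega_l p t : (p + size t = r.+1)%N -> chain_of p (c^~ t) \in Omega R X p.
Proof.
move=> pt; have cE s : pcoef (chain_of p (c^~ t)) s = c s t.
  have [sz|sz] := eqVneq (size s) p.+1; last first.
    by rewrite pcoef_size // unstair_size // addnC -(eqn_add2l p) addnA; lia.
  have [rs|rs] := boolP (regular s); first by rewrite pcoef_chain_of.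
  by rewrite pcoef_nreg // unstair_reg // negb_and rs.
apply/OmegaP; split=> [s ns|s s0 rs ns].
  by rewrite cE unstair_allowed // negb_and ns.
rewrite (eq_ins (f2 := c^~ t)) => [|s' _]; last exact: cE.
have [At|nt] := boolP (allowed t); last first.
  by rewrite ins0 // => s' _; rewrite unstair_allowed // negb_and nt orbT.
case: (eqVneq t [::]) => [->|t0]; first by rewrite ins0 // => -[].
have := tbd_unstair s0 t0 rs (allowed_regular At); rewrite negb_and ns => /(_ isT).
rewrite /tbd [X in _ + _ * X]ins0 ?mulr0 ?addr0 // => t' _.
by rewrite unstair_allowed // negb_and ns.
Qed.

Lemma unstair_Omega_r q s : (size s + q = r.+1)%N -> chain_of q (c s) \in Omega R Y q.
Proof.
move=> qs; have cE t : pcoef (chain_of q (c s)) t = c s t.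
  have [sz|sz] := eqVneq (size t) q.+1; last first.
    by rewrite pcoef_size // unstair_size //; lia.
  have [rs|rs] := boolP (regular t); first by rewrite pcoef_chain_of.
  by rewrite pcoef_nreg // unstair_reg // negb_and rs orbT.
apply/OmegaP; split=> [t nt|t t0 rt nt].
  by rewrite cE unstair_allowed // negb_and nt orbT.
rewrite (eq_ins (f2 := c s)) => [|s' _]; last exact: cE.
have [As|ns] := boolP (allowed s); last first.
  by rewrite ins0 // => s' _; rewrite unstair_allowed // negb_and ns.
case: (eqVneq s [::]) => [->|s0]; first by rewrite ins0 // => -[].
have := tbd_unstair s0 t0 (allowed_regular As) rt; rewrite negb_and nt orbT => /(_ isT).
rewrite /tbd ins0 ?add0r => [/eqP|s' _]; first by rewrite mulf_eq0 signr_eq0 => /eqP.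
by rewrite unstair_allowed // negb_and nt orbT.
Qed.

(** Cross products span Omega of the box product, in the form that their
    orthogonal complement is 0. Contracting the double chain c of w with the slice
    u = c (., t) gives v in Omega, which is orthogonal to itself because u x v is
    orthogonal to w. So v = 0, and its coefficient at t is the
    squared norm of the slice u. *)
Lemma Omega_cross_orth :
  (forall p q (u : chain R X p) (v : chain R Y q), r = (p + q)%N ->
     u \in Omega R X p -> v \in Omega R Y q -> inner (cross r u v) w = 0) ->
  w = 0.
Proof.
move=> H; apply: pcoefP => z _ _; rewrite pcoef0 pcoef_unstair.
case: z => [|[a b] z] //; rewrite /xprod shuffle0 // => s0 t0 rs rt.
set s := a :: s0; set t := b :: t0.
have [sz|sz] := eqVneq (size s + size t)%N r.+2; last exact: unstair_size.
pose p := size s0; pose q := size t0.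
have rpq : r = (p + q)%N by rewrite /p /q; move: sz; rewrite /= ; lia.
(* The slice u through t; the goal is that its coefficient at s is 0. *)
pose u := chain_of p (c^~ t).
have Ou : u \in Omega R X p by apply: unstair_Omega_l; rewrite /= ; lia.
pose v := \sum_(x : rpath X p) u x *: chain_of q (c (val (val x))).
have Ov : v \in Omega R Y q.
  apply: memv_suml => x _; apply: memvZ; apply: unstair_Omega_r.
  by rewrite size_tuple; lia.
have vE y : size y = q.+1 -> regular y ->
    pcoef v y = sumseq p.+1 (fun x => pcoef u x * c x y).
  move=> sy ry; rewrite sumseq_pcoef pcoef_sum; apply: eq_bigr => x _.
  by rewrite pcoefZ pcoef_chain_of.
have v0 : v = 0.
  apply: inner_eq0; have := H p q u v rpq Ou Ov.
  rewrite (inner_cross_gen u v rpq pcoef_unstair) => /eqP.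
  rewrite !mulf_eq0 !invr_eq0 !pnatr_eq0 !(negbTE (lt0n_neq0 (fact_gt0 _))) !orFb => /eqP E.
  rewrite innerE /pairing -[RHS](mulr0 (q`!%:R)^-1) -E; congr (_ * _).
  rewrite (eq_sumseq (f2 := fun x => pcoef u x * sumseq q.+1 (fun y => pcoef v y * c x y))).
    rewrite !sumseq_pcoef.
    under eq_bigr => y _ do rewrite vE ?size_tuple ?(valP y) // sumseq_pcoef mulr_sumr.
    rewrite exchange_big; apply: eq_bigr => x _.
    by rewrite sumseq_pcoef mulr_sumr; apply: eq_bigr => y _; rewrite mulrCA.
  by move=> x _; rewrite -sumseqZ; apply: eq_sumseq => y _; rewrite /tensor mulrA.
have : pcoef v t = 0 by rewrite v0 pcoef0.
rewrite vE // => E.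
have u0 : u = 0.
  apply: inner_eq0; rewrite innerE /pairing -[RHS](mulr0 (p`!%:R)^-1) -E; congr (_ * _).
  apply: eq_sumseq => x sx.
  have [rx|nx] := boolP (regular x); first by rewrite [in X in _ * X]pcoef_chain_of.
  by rewrite (pcoef_nreg u nx) !mul0r.
by have := pcoef_chain_of (c^~ t) (erefl (size s)) rs; rewrite -/u u0 pcoef0.
Qed.

End Slices.
End Kunneth.

(** * Spectral theorem for symmetric operators *)

Section ComplexEigen.
Variables (R : rcfType).

Lemma ReM (x : R[i]) (k : R) : complex.Re (x * (k%:C)%C) = complex.Re x * k.
Proof. by case: x => a b /=; rewrite mulr0 subr0. Qed.
Lemma ImM (x : R[i]) (k : R) : complex.Im (x * (k%:C)%C) = complex.Im x * k.
Proof. by case: x => a b /=; rewrite mulr0 add0r. Qed.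

Lemma Re_sum (I : finType) (F : I -> R[i]) : complex.Re (\sum_i F i) = \sum_i complex.Re (F i).
Proof. by apply: (big_morph (@complex.Re R)) => // -[a b] [c d]. Qed.
Lemma Im_sum (I : finType) (F : I -> R[i]) : complex.Im (\sum_i F i) = \sum_i complex.Im (F i).
Proof. by apply: (big_morph (@complex.Im R)) => // -[a b] [c d]. Qed.

(** Real and imaginary parts of a complex eigenvector. *)
Lemma mx_complex_eigen n (M : 'M[R]_n) : (0 < n)%N ->
  exists a b (x y : 'rV[R]_n), [/\ (x != 0) || (y != 0),
    x *m M = a *: x - b *: y & y *m M = b *: x + a *: y].
Proof.
move=> n0; pose M' := map_mx (real_complex R) M.
have /closed_rootP[z] : size (char_poly M') != 1%N by rewrite size_char_poly; lia.
rewrite -eigenvalue_root_char => /eigenvalueP[v vM v0].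
have Re_mul j : (map_mx (@complex.Re R) v *m M) 0 j = complex.Re ((v *m M') 0 j).
  by rewrite !mxE Re_sum; apply: eq_bigr => i _; rewrite !mxE ReM.
have Im_mul j : (map_mx (@complex.Im R) v *m M) 0 j = complex.Im ((v *m M') 0 j).
  by rewrite !mxE Im_sum; apply: eq_bigr => i _; rewrite !mxE ImM.
exists (complex.Re z), (complex.Im z), (map_mx (@complex.Re R) v), (map_mx (@complex.Im R) v).
split.
- rewrite -negb_and; apply: contra v0 => /andP[/eqP/rowP h1 /eqP/rowP h2].
  apply/eqP/rowP => j; have := h1 j; have := h2 j; rewrite !mxE.
  by case: (v 0 j) => a b /= -> ->.
- by apply/rowP=> j; rewrite Re_mul vM !mxE; case: z {vM} => a b; case: (v 0 j).
- apply/rowP=> j; rewrite Im_mul vM !mxE; case: z {vM} => a b; case: (v 0 j) => c d /=.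
  by ring.
Qed.

End ComplexEigen.

Lemma char_poly_conj (F : comNzRingType) n (P A Q : 'M[F]_n) :
  P *m Q = 1%:M -> char_poly (P *m A *m Q) = char_poly A.
Proof.
move=> PQ; rewrite /char_poly /char_poly_mx.
pose c := @map_mx F {poly F} (polyC) n n.
have PQ' : c P *m c Q = 1%:M by rewrite /c -map_mxM PQ map_mx1.
have -> : 'X%:M - c (P *m A *m Q) = c P *m ('X%:M - c A) *m c Q.
  rewrite mulmxBr mulmxBl /c !map_mxM; congr (_ - _).
  by rewrite mul_mx_scalar -scalemxAl PQ' scalemx1.
rewrite !det_mulmx mulrAC -det_mulmx PQ' det1 mul1r.
by [].
Qed.

(** In an eigenbasis the matrix is diagonal, and the characteristic polynomial
    does not depend on the basis. *)
Lemma spec_eigenbasis (R : realType) (vT : vectType R) (f : 'End(vT)) (L : seq (vT * R)) :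
  basis_of fullv (unzip1 L) -> (forall x, x \in L -> f x.1 = x.2 *: x.1) ->
  perm_eq (spec f) (unzip2 L).
Proof.
move=> bL eL.
have szL : size (unzip1 L) == \dim {:vT} by rewrite -(eqP (basis_free bL)) (span_basis bL).
pose e' : (\dim {:vT}).-tuple vT := Tuple szL.
have be' : basis_of fullv e' by [].
have be := vbasisP {:vT}.
have cE : char_pol f = \prod_(y <- unzip2 L) ('X - y%:P).
  rewrite /char_pol; set e := vbasis _.
  have -> : passmx.mxof e e f =
      passmx.mxof e e' \1%VF *m passmx.mxof e' e' f *m passmx.mxof e' e \1%VF.
    by rewrite -!(passmx.mxof_comp _ _ be') comp_lfun1r comp_lfun1l.
  rewrite char_poly_conj; last first.
    by rewrite -(passmx.mxof_comp _ _ be') comp_lfun1l passmx.mxof1 ?(basis_free be).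
  have szL2 : size L = \dim {:vT} by rewrite -(eqP szL) size_map.
  have mE i j : passmx.mxof e' e' f i j = (i == j)%:R * (unzip2 L)`_i.
    rewrite !mxE /= passmx.vecof_delta /=.
    have iL : (i < size L)%N by rewrite szL2.
    rewrite (nth_map (0, 0)) // eL ?mem_nth // linearZ /=.
    rewrite (nth_map (0, 0) 0 snd) // mulrC; congr (_ * _).
    rewrite -(nth_map (0, 0) 0 fst) //.
    by rewrite -[nth 0 _ i]/(e'`_i) coord_free ?(basis_free be').
  rewrite char_poly_trig; last first.
    apply/is_trig_mxP => i j ij; rewrite mE; case: eqP => [ij'|]; rewrite ?mul0r //.
    by rewrite ij' ltnn in ij.
  rewrite (eq_bigr (fun i : 'I__ => 'X - ((unzip2 L)`_i)%:P)); last first.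
    by move=> i _; rewrite mE eqxx mul1r.
  by rewrite (big_nth 0) size_map szL2 big_mkord.
apply/allP => x _; rewrite inE count_spec cE; apply/eqP.
exact: mu_prod_XsubC.
Qed.

Lemma linear_eq0_span (R : fieldType) (vT : vectType R) (g : vT -> R) (s : seq vT) :
  (forall a u v, g (a *: u + v) = a * g u + g v) ->
  {in s, forall v, g v = 0} -> {in <<s>>%VS, forall v, g v = 0}.
Proof.
move=> gl gs v /(@coord_span _ _ _ (in_tuple s)) ->.
elim/big_ind: _ => [|x y gx gy|i _].
- by have := gl (-1) 0 0; rewrite scaler0 addr0 mulN1r addNr.
- by rewrite -[x]scale1r gl gx gy mulr0 addr0.
- have g0 : g 0 = 0 by have := gl (-1) 0 0; rewrite scaler0 addr0 mulN1r addNr.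
  by rewrite -[_ *: _]addr0 gl g0 addr0 gs ?mulr0 // mem_nth.
Qed.

Section SymmetricForm.
Variables (R : realType) (vT : vectType R) (B : vT -> vT -> R).
Hypothesis Bl : forall a u v w, B (a *: u + v) w = a * B u w + B v w.
Hypothesis BC : forall u v, B u v = B v u.
Hypothesis Bge0 : forall u, 0 <= B u u.
Hypothesis Beq0 : forall u, B u u = 0 -> u = 0.

Lemma form0l v : B 0 v = 0.
Proof. by have := Bl (-1) 0 0 v; rewrite scaler0 addr0 mulN1r addNr. Qed.

Lemma formZl a u v : B (a *: u) v = a * B u v.
Proof. by rewrite -[a *: u]addr0 Bl form0l addr0. Qed.

Definition orth u v := B u v == 0.

Lemma orth_span (s : seq vT) u :
  (forall v, v \in s -> B u v = 0) -> forall x, x \in <<s>>%VS -> B u x = 0.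
Proof.
by move=> us; apply: (@linear_eq0_span _ _ (B u)) => // a v w; rewrite BC Bl !(BC u).
Qed.

Lemma orth_free (s : seq vT) : all (fun v => v != 0) s -> pairwise orth s -> free s.
Proof.
elim: s => [|u s IHs] /=; first by rewrite nil_free.
case/andP=> u0 s0 /andP[us ps]; rewrite free_cons IHs // andbT.
apply: contra u0 => uspan; apply/eqP/Beq0/(orth_span _ uspan) => v vs.
exact/eqP/(allP us).
Qed.

(** Gram-Schmidt: subtract the projections one by one. *)
Lemma orth_proj (s : seq vT) w : all (fun v => v != 0) s -> pairwise orth s ->
  exists2 x, x \in <<s>>%VS & forall v, v \in s -> B (w - x) v = 0.
Proof.
elim: s => [|u s IHs] /=; first by exists 0; rewrite ?mem0v.
case/andP=> u0 s0 /andP[us ps]; have [x xs xw] := IHs s0 ps.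
have Bu : B u u != 0 by apply: contra u0 => /eqP/Beq0->.
pose k := B (w - x) u / B u u.
exists (x + k *: u).
  rewrite span_cons addrC memv_add // memvZ // memv_line //.
move=> v; have -> : w - (x + k *: u) = (- k) *: u + (w - x).
  by rewrite scaleNr opprD addrA [in RHS]addrC.
rewrite inE Bl => /predU1P[->|vs]; first by rewrite /k mulNr divfK // addNr.
by rewrite xw // (eqP (allP us v vs)) mulr0 addr0.
Qed.

Lemma orth_basis (s : seq vT) : all (fun v => v != 0) s -> pairwise orth s ->
  (forall w, (forall v, v \in s -> B w v = 0) -> w = 0) -> basis_of fullv s.
Proof.
move=> s0 ps cs; rewrite basisEfree orth_free // subvf /=.
have sp : (fullv <= <<s>>)%VS.
  apply/subvP => w _; have [x xs /cs/eqP] := orth_proj w s0 ps.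
  by rewrite subr_eq0 => /eqP->.
by rewrite -(eqP (orth_free s0 ps)) dimvS.
Qed.

Variable f : 'End(vT).
Hypothesis fsym : forall u v, B (f u) v = B u (f v).

(** If u + i w is a complex eigenvector for the eigenvalue a + i b, then symmetry
    applied to u and w gives b ((u, u) + (w, w)) = 0. So b = 0, and whichever of
    u and w is nonzero is a real eigenvector. *)
Lemma real_eigenvector (W : {vspace vT}) : W != 0%VS -> (f @: W <= W)%VS ->
  exists l v, [/\ v \in W, v != 0 & f v = l *: v].
Proof.
move=> W0 fW; pose e := vbasis W.
pose M := \matrix_(i < \dim W, j < \dim W) coord e j (f e`_i).
have [|a [b [x [y [xy0 xM yM]]]]] := mx_complex_eigen M; first by rewrite lt0n dimv_eq0.
(* lc turns coordinates into vectors and intertwines M with f. *)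
pose lc (z : 'rV[R]_(\dim W)) := \sum_i z 0 i *: e`_i.
have eW (i : 'I_(\dim W)) : e`_i \in W by rewrite vbasis_mem // mem_nth // size_tuple.
have lcW z : lc z \in W by apply: memv_suml => i _; rewrite memvZ.
have flc z : f (lc z) = lc (z *m M).
  rewrite /lc linear_sum.
  under eq_bigr => i _.
    rewrite linearZ /= (coord_vbasis (_ : f e`_i \in W)); last first.
      by apply: (subvP fW); apply: memv_img.
    rewrite scaler_sumr; over.
  rewrite exchange_big; apply: eq_bigr => j _ /=.
  rewrite mxE scaler_suml; apply: eq_bigr => i _.
  by rewrite scalerA mxE.
have lcZD k z t : lc (k *: z + t) = k *: lc z + lc t.
  rewrite /lc scaler_sumr -big_split; apply: eq_bigr => i _.
  by rewrite !mxE scalerDl scalerA.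
have lc0 z : lc z = 0 -> z = 0.
  have /freeP efree := basis_free (vbasisP W).
  by move=> /(efree (fun i => z 0 i)) z0; apply/rowP=> i; rewrite z0 mxE.
pose u := lc x; pose w := lc y.
have fu : f u = a *: u - b *: w.
  by rewrite /u flc xM -scaleNr lcZD scaleNr -[- (b *: y)]addr0 -scaleNr lcZD
     /lc [X in _ + (_ + X)]big1 ?addr0 ?scaleNr // => i _; rewrite mxE scale0r.
have fw : f w = b *: u + a *: w.
  by rewrite /w flc yM lcZD -[a *: y]addr0 lcZD
     /lc [X in _ + (_ + X)]big1 ?addr0 // => i _; rewrite mxE scale0r.
have b0 : b = 0.
  have := fsym u w; rewrite fu fw -scaleNr addrC Bl formZl [in RHS]BC Bl formZl.
  rewrite (BC w u) => /eqP; rewrite -subr_eq0 => /eqP E.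
  have : b * (B u u + B w w) = 0 by move: E => E; rewrite -[LHS]opprK -[RHS]oppr0 -E; ring.
  move/eqP; rewrite mulf_eq0 => /orP[/eqP//|].
  rewrite paddr_eq0 ?Bge0 // => /andP[/eqP/Beq0/lc0 x0 /eqP/Beq0/lc0 y0].
  by rewrite x0 y0 eqxx in xy0.
move: fu fw; rewrite b0 !scale0r subr0 add0r => fu fw.
case/orP: xy0 => [x0|y0].
  by exists a, u; split; [exact: lcW|apply: contra x0 => /eqP/lc0->|].
by exists a, w; split; [exact: lcW|apply: contra y0 => /eqP/lc0->|].
Qed.

(** An orthogonal family of eigenvectors which is not complete can be extended,
    because its orthogonal complement is stable under f. *)
Lemma spectral_theorem : exists L : seq (vT * R),
  [/\ all (fun v => v != 0) (unzip1 L), pairwise orth (unzip1 L),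
      basis_of fullv (unzip1 L) & forall x, x \in L -> f x.1 = x.2 *: x.1].
Proof.
pose good (L : seq (vT * R)) := [/\ all (fun v => v != 0) (unzip1 L),
  pairwise orth (unzip1 L) & forall x, x \in L -> f x.1 = x.2 *: x.1].
suff H k L : good L -> (\dim {:vT} <= size L + k)%N -> exists L', [/\
    all (fun v => v != 0) (unzip1 L'), pairwise orth (unzip1 L'),
    basis_of fullv (unzip1 L') & forall x, x \in L' -> f x.1 = x.2 *: x.1].
  by apply: (H (\dim {:vT}) [::]).
elim: k L => [|k IHk] L [L0 pL eL] sz.
  exists L; split=> //; rewrite basisEfree orth_free // subvf size_map.
  by rewrite addn0 in sz.
pose F (w : vT) : 'rV[R]_(size L) := \row_i B w (unzip1 L)`_i.
have Flin : linear F by move=> c u v; apply/rowP=> i; rewrite !mxE Bl.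
pose Fl : {linear vT -> 'rV[R]_(size L)} := HB.pack F
  (GRing.isLinear.Build R vT 'rV[R]_(size L) _ F Flin).
pose W := lker (linfun Fl).
have WP w : reflect (forall v, v \in unzip1 L -> B w v = 0) (w \in W).
  rewrite memv_ker lfunE /=; apply: (iffP eqP) => [/rowP Fw v|H].
    case/(nthP 0) => i; rewrite size_map => iL <-.
    by have := Fw (Ordinal iL); rewrite !mxE.
  by apply/rowP=> i; rewrite !mxE H // mem_nth // size_map.
have [W0|W0] := eqVneq W 0%VS.
  exists L; split=> //; apply: orth_basis => // w /WP.
  by rewrite W0 memv0 => /eqP.
have fW : (f @: W <= W)%VS.
  apply/subvP => _ /memv_imgP[w /WP wW ->]; apply/WP => v vL.
  have [x xL ->] := mapP vL.
  by rewrite fsym eL // BC formZl BC wW ?mulr0 // map_f.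
have [l [v [/WP vW v0 fv]]] := real_eigenvector W0 fW.
apply: (IHk ((v, l) :: L)); last by rewrite /= addSnnS.
split=> /=; first by rewrite v0.
  by rewrite pL andbT; apply/allP => u uL; rewrite /orth vW.
by move=> x; rewrite inE => /predU1P[->|/eL].
Qed.

End SymmetricForm.

(** * The Laplacian of a box product *)

Section Hodge.
Variables (R : realType) (G : digraph).
Local Notation Om p := (subvs_of (Omega R G p)).
Local Notation d p := (boundaryO R G p).
Local Notation delta p := (adjoint (boundaryO R G p)).

Lemma innerDr p a (u v w : chain R G p) :
  inner w (a *: u + v) = a * inner w u + inner w v.
Proof. by rewrite innerC innerDl !(innerC w). Qed.

Definition innerO p (u v : Om p) : R := inner (vsval u) (vsval v).

Lemma innerO_l p a (u v w : Om p) : innerO (a *: u + v) w = a * innerO u w + innerO v w.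
Proof. exact: innerDl. Qed.

Lemma innerOC p (u v : Om p) : innerO u v = innerO v u.
Proof. exact: innerC. Qed.

Lemma innerO_ge0 p (u : Om p) : 0 <= innerO u u.
Proof.
rewrite /innerO /inner mulr_ge0 ?invr_ge0 ?ler0n // sumr_ge0 // => t _.
exact: sqr_ge0.
Qed.

Lemma innerO_eq0 p (u : Om p) : innerO u u = 0 -> u = 0.
Proof. by move/inner_eq0 => u0; apply: val_inj. Qed.

Lemma LaplacianE p u :
  Laplacian R G p u = d p.+1 (delta p.+1 u) + delta p (d p u).
Proof. by rewrite add_lfunE !comp_lfunE. Qed.

Lemma Laplacian_sym p u v : innerO (Laplacian R G p u) v = innerO u (Laplacian R G p v).
Proof.
have adj n x y : innerO (d n x) y = innerO x (delta n y) by apply: adjointP.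
have innerO_r x y z : innerO (p := p) x (y + z) = innerO x y + innerO x z.
  by rewrite innerOC -[y]scale1r innerO_l mul1r scale1r !(innerOC x).
rewrite !LaplacianE innerO_r innerOC innerO_r; congr (_ + _).
  by rewrite innerOC (adj p.+1) innerOC -(adj p.+1) innerOC.
by rewrite -adj innerOC -adj.
Qed.

Lemma pairing_size p p' (u : chain R G p') (f : seq G -> R) : p != p' -> pairing p f (pcoef u) = 0.
Proof.
move=> pp; rewrite /pairing sumseq0 ?mulr0 // => s sz.
by rewrite (pcoef_size u) ?mulr0 // sz eqSS.
Qed.

(** Adjointness of the boundary without a relation between p and p': outside
    p' = p.+1 both sides are 0, including p = p' = 0, where p'.-1 = p. *)
Lemma pairing_adj p p' (u : Om p) (u' : Om p') :
  pairing p (pcoef (vsval u)) (pcoef (boundary R G p' (vsval u'))) =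
  pairing p.+1 (pcoef (vsval (delta p.+1 u))) (pcoef (vsval u')).
Proof.
have [e|pp] := eqVneq p' p.+1.
  subst p'; rewrite -innerE -boundaryOE -innerE innerC (innerC (vsval (delta p.+1 u))).
  exact: adjointP.
rewrite [RHS]pairing_size 1?eq_sym //.
case: p' u' pp => [|p'] u' pp; last by rewrite pairing_size //= eq_sym -eqSS.
by rewrite boundary0 lfunE /= /pairing sumseq0 ?mulr0 // => s _; rewrite pcoef0 mulr0.
Qed.

End Hodge.

Section ProductLaplacian.
Variables (R : realType) (X Y : digraph).
Local Notation Z := (box X Y).
Local Notation Om G p := (subvs_of (Omega R G p)).
Local Notation d G p := (boundaryO R G p).
Local Notation delta G p := (adjoint (boundaryO R G p)).

(** The cross product as an element of Omega, where it lies when r = p + q; the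
    projection then leaves it unchanged. *)
Definition crossO r p q (u : Om X p) (v : Om Y q) : Om Z r :=
  vsproj (Omega R Z r) (cross r (vsval u) (vsval v)).

Lemma crossOE r p q (u : Om X p) (v : Om Y q) : r = (p + q)%N ->
  vsval (crossO r u v) = cross r (vsval u) (vsval v).
Proof. by move=> rpq; rewrite vsprojK // cross_Omega // subvsP. Qed.

(** Both sides are in Omega, so it is enough to pair them with all cross
    products u' x v' of degree r.+1. The adjoint moves the boundary onto
    u' x v', and the Leibniz rule and the isometry reduce
    the claim to adjointness on the factors; the signs (-1)^p and (-1)^p' agree as
    (u, u') = 0 unless p = p'. *)
Lemma delta_cross r p q (u : Om X p) (v : Om Y q) : r = (p + q)%N ->
  vsval (delta Z r.+1 (crossO r u v)) =
  cross r.+1 (vsval (delta X p.+1 u)) (vsval v) +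
  (-1) ^+ p *: cross r.+1 (vsval u) (vsval (delta Y q.+1 v)).
Proof.
move=> rpq; set D := _ + _.
have OD : D \in Omega R Z r.+1.
  by rewrite memvD ?memvZ // cross_Omega ?subvsP // rpq ?addnS.
apply/eqP; rewrite -subr_eq0; apply/eqP.
apply: Omega_cross_orth => [|p' q' u' v' rpq' Ou' Ov'].
  by rewrite memvB // subvsP.
pose u0 : Om X p' := Subvs Ou'; pose v0 : Om Y q' := Subvs Ov'.
have -> : u' = vsval u0 by [].
have -> : v' = vsval v0 by [].
pose W : Om Z r.+1 := crossO r.+1 u0 v0.
have WE : vsval W = cross r.+1 (vsval u0) (vsval v0) by apply: crossOE.
suff E : inner (cross r.+1 (vsval u0) (vsval v0)) (vsval (delta Z r.+1 (crossO r u v))) =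
    inner (cross r.+1 (vsval u0) (vsval v0)) D.
  by rewrite addrC -scaleN1r innerDr E mulN1r addNr.
have := adjointP (d Z r.+1) W (crossO r u v).
rewrite boundaryOE WE /= => <-; rewrite crossOE // boundary_cross //=.
rewrite [X in inner X _ = _]addrC innerDl /D [X in _ = inner _ X]addrC innerDr.
rewrite ![inner _ (cross r (vsval u) (vsval v))]innerC.
rewrite (inner_cross_tensor _ _ rpq (fun z => pcoef_cross_bdl _ _ z rpq')).
rewrite (inner_cross_tensor _ _ rpq (fun z => pcoef_cross_bdr _ _ z rpq')).
rewrite innerC inner_cross ?rpq ?addnS // -?rpq //.
rewrite [inner _ (cross r.+1 (vsval (delta X p.+1 u)) _)]innerC inner_cross ?rpq // -?rpq //.
rewrite (pairing_adj u u0) (pairing_adj v v0); congr (_ + _).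
have [pp|pp] := eqVneq p p'; first by subst p'.
by rewrite (pairing_size u' _ pp) !mul0r !mulr0.
Qed.

Lemma crossO0l r p q (v : Om Y q) : crossO r (0 : Om X p) v = 0.
Proof. by rewrite /crossO linear0 cross0l linear0. Qed.

Lemma crossO0r r p q (u : Om X p) : crossO r u (0 : Om Y q) = 0.
Proof. by rewrite /crossO linear0 cross0r linear0. Qed.

Lemma bdO0 (G : digraph) (u : Om G 0) : d G 0 u = 0.
Proof. by apply: val_inj; rewrite [LHS](boundaryOE u) boundary0 lfunE. Qed.

Lemma bd_crossO r p q (u : Om X p) (v : Om Y q) : r = (p + q)%N ->
  d Z r (crossO r u v) = crossO r.-1 (d X p u) v + (-1) ^+ p *: crossO r.-1 u (d Y q v).
Proof.
move=> rpq; apply: val_inj; rewrite [LHS]boundaryOE crossOE // boundary_cross //.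
rewrite linearD linearZ /=; congr (_ + _ *: _).
  case: p u rpq => [|p] u rpq; last by rewrite crossOE ?boundaryOE // rpq.
  by rewrite bdO0 crossO0l boundary0 lfunE /= cross0l.
case: q v rpq => [|q] v rpq; last by rewrite crossOE ?boundaryOE // rpq addnS.
by rewrite bdO0 crossO0r boundary0 lfunE /= cross0r.
Qed.

Lemma delta_crossO r p q (u : Om X p) (v : Om Y q) : r = (p + q)%N ->
  delta Z r.+1 (crossO r u v) =
  crossO r.+1 (delta X p.+1 u) v + (-1) ^+ p *: crossO r.+1 u (delta Y q.+1 v).
Proof.
move=> rpq; apply: val_inj; rewrite [LHS]delta_cross // linearD linearZ /=.
by rewrite !crossOE ?rpq ?addnS.
Qed.

Lemma delta_crossO_bdl r p q (u : Om X p) (v : Om Y q) : r = (p + q)%N ->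
  delta Z r (crossO r.-1 (d X p u) v) =
  crossO r (delta X p (d X p u)) v + (-1) ^+ p.-1 *: crossO r (d X p u) (delta Y q.+1 v).
Proof.
move=> ->; case: p u => [|p] u; last by rewrite delta_crossO.
by rewrite bdO0 !linear0 !crossO0l linear0 scaler0 addr0.
Qed.

Lemma delta_crossO_bdr r p q (u : Om X p) (v : Om Y q) : r = (p + q)%N ->
  delta Z r (crossO r.-1 u (d Y q v)) =
  crossO r (delta X p.+1 u) (d Y q v) + (-1) ^+ p *: crossO r u (delta Y q (d Y q v)).
Proof.
move=> ->; case: q v => [|q] v; last by rewrite addnS delta_crossO.
by rewrite bdO0 !linear0 !crossO0r linear0 scaler0 addr0.
Qed.

Lemma crossODl r p q (u1 u2 : Om X p) (v : Om Y q) :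
  crossO r (u1 + u2) v = crossO r u1 v + crossO r u2 v.
Proof.
by rewrite /crossO linearD /= -[vsval u1]scale1r crossDl scale1r linearD scale1r.
Qed.

Lemma crossODr r p q (u : Om X p) (v1 v2 : Om Y q) :
  crossO r u (v1 + v2) = crossO r u v1 + crossO r u v2.
Proof.
by rewrite /crossO linearD /= -[vsval v1]scale1r crossDr scale1r linearD scale1r.
Qed.

Lemma crossOZl r p q k (u : Om X p) (v : Om Y q) :
  crossO r (k *: u) v = k *: crossO r u v.
Proof. by rewrite /crossO linearZ /= crossZl linearZ. Qed.

Lemma crossOZr r p q k (u : Om X p) (v : Om Y q) :
  crossO r u (k *: v) = k *: crossO r u v.
Proof. by rewrite /crossO linearZ /= crossZr linearZ. Qed.

(** The mixed terms are (boundary u) x (delta v) and (delta u) x (boundary v).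
    Each occurs twice with opposite signs, because boundary and delta shift the degree
    of u, and with it the sign of the Leibniz rule. *)
Lemma Laplacian_cross r p q (u : Om X p) (v : Om Y q) : r = (p + q)%N ->
  Laplacian R Z r (crossO r u v) =
  crossO r (Laplacian R X p u) v + crossO r u (Laplacian R Y q v).
Proof.
move=> rpq; rewrite LaplacianE delta_crossO // bd_crossO // !linearD !linearZ /=.
rewrite delta_crossO_bdl // delta_crossO_bdr //.
have rl : r.+1 = (p.+1 + q)%N by rewrite rpq.
have rr : r.+1 = (p + q.+1)%N by rewrite rpq addnS.
rewrite (bd_crossO _ _ rl) (bd_crossO _ _ rr) /=.
rewrite !LaplacianE crossODl crossODr.
have ss : (-1) ^+ p * (-1) ^+ p = 1 :> R by rewrite -exprMn mulrNN mulr1 expr1n.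
rewrite !scalerDr !scalerA ss !scale1r exprS mulN1r scaleNr.
(* For p = 0 the exponent p.-1 has the wrong parity, but then d X 0 u = 0. *)
have -> : (-1) ^+ p.-1 *: crossO r (d X p u) (delta Y q.+1 v) =
    - ((-1) ^+ p *: crossO r (d X p u) (delta Y q.+1 v)).
  case: p u {rpq ss rl rr} => [|p] u; last by rewrite exprS mulN1r scaleNr opprK.
  by rewrite bdO0 crossO0l !scaler0 oppr0.
rewrite addrACA [X in X + _ = _]addrACA [X in _ + X = _]addrACA -opprD.
by rewrite [x in _ - x]addrC [LHS]addrA subrK.
Qed.

Lemma innerO_cross r p q p' q' (u : Om X p) (v : Om Y q) (u' : Om X p') (v' : Om Y q') :
  r = (p + q)%N -> r = (p' + q')%N -> innerO (crossO r u v) (crossO r u' v') =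
  pairing p (pcoef (vsval u)) (pcoef (vsval u')) * pairing q (pcoef (vsval v)) (pcoef (vsval v')).
Proof. by move=> rpq rpq'; rewrite /innerO !crossOE // inner_cross. Qed.

End ProductLaplacian.

(** * The spectrum *)

Section BigCat.
Variables (T : Type).
Implicit Type (F : nat -> seq T).

Lemma all_bigcat (a : pred T) n F :
  (forall i, (i < n)%N -> all a (F i)) -> all a (\big[cat/[::]]_(i < n) F i).
Proof. by move=> aF; elim/big_ind: _ => // [s t|i _]; [rewrite all_cat => -> -> | exact: aF]. Qed.

Lemma pairwise_bigcat (e : rel T) n F :
  (forall i, (i < n)%N -> pairwise e (F i)) ->
  (forall i j, (i < j < n)%N -> allrel e (F i) (F j)) ->
  pairwise e (\big[cat/[::]]_(i < n) F i).
Proof.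
elim: n => [|n IHn] pF aF; first by rewrite big_ord0.
rewrite big_ord_recr pairwise_cat pF // IHn /= ?andbT.
- by apply: all_bigcat => i ilt; apply: aF; rewrite ilt /=.
- by move=> i ilt; apply: pF; apply: ltnW.
- by move=> i j /andP[ij jn]; apply: aF; rewrite ij ltnW.
Qed.

End BigCat.

Lemma mem_bigcat (T : eqType) n (F : nat -> seq T) i y :
  (i < n)%N -> y \in F i -> y \in \big[cat/[::]]_(i < n) F i.
Proof.
elim: n => // n IHn; rewrite ltnS leq_eqVlt big_ord_recr mem_cat.
by case/predU1P=> [-> ->|/IHn H /H ->]; rewrite ?orbT.
Qed.

Lemma all_allpairs (S T U : Type) (a : pred S) (b : pred T) (c : pred U)
    (f : S -> T -> U) s t :
  (forall x y, a x -> b y -> c (f x y)) -> all a s -> all b t ->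
  all c [seq f x y | x <- s, y <- t].
Proof.
move=> abc + bt; elim: s => //= x s IHs /andP[ax as_]; rewrite all_cat IHs // andbT.
rewrite all_map; apply: sub_all bt => y; exact: abc.
Qed.

Lemma pairwise_allpairs (S T U : Type) (a : rel S) (b : rel T) (c : rel U)
    (f : S -> T -> U) s t :
  (forall x y x' y', a x x' -> c (f x y) (f x' y')) ->
  (forall x y y', b y y' -> c (f x y) (f x y')) ->
  pairwise a s -> pairwise b t -> pairwise c [seq f x y | x <- s, y <- t].
Proof.
move=> ac bc + bt; elim: s => //= x s IHs /andP[ax as_]; rewrite pairwise_cat IHs // andbT.
have -> : pairwise c (map (f x) t).
  by rewrite pairwise_map; apply: sub_pairwise bt => y y' byy; apply: bc.
rewrite andbT /allrel all_map; apply: (sub_all (a1 := predT)); last exact: all_predT.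
move=> y _ /=; apply: (all_allpairs (a := a x) (b := predT)) => //.
  by move=> x' y' axx _; apply: ac.
exact: all_predT.
Qed.

Lemma Laplacian_eigenbasis (R : realType) (G : digraph) p :
  exists L : seq (subvs_of (Omega R G p) * R),
  [/\ all (fun v => v != 0) (unzip1 L), pairwise (orth (@innerO R G p)) (unzip1 L),
      basis_of fullv (unzip1 L) & forall x, x \in L -> Laplacian R G p x.1 = x.2 *: x.1].
Proof.
apply: spectral_theorem.
- exact: innerO_l.
- exact: innerOC.
- exact: innerO_ge0.
- exact: innerO_eq0.
- exact: Laplacian_sym.
Qed.

Theorem proposition6p3 (R : realType) (X Y : digraph) (r : nat) :
  perm_eq (spec (Laplacian R (box X Y) r))
          (\big[cat/[::]]_(p < r.+1)
             msum (spec (Laplacian R X p)) (spec (Laplacian R Y (r - p)))).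
Proof.
pose LX p := projT1 (cid (Laplacian_eigenbasis R X p)).
have LXP p := projT2 (cid (Laplacian_eigenbasis R X p)).
pose LY p := projT1 (cid (Laplacian_eigenbasis R Y p)).
have LYP p := projT2 (cid (Laplacian_eigenbasis R Y p)).
pose F p : seq (subvs_of (Omega R (box X Y) r) * R) :=
  [seq (crossO r x.1 y.1, x.2 + y.2) | x <- LX p, y <- LY (r - p)%N].
pose LZ := \big[cat/[::]]_(p < r.+1) F p.
have LZ1 : unzip1 LZ = \big[cat/[::]]_(p < r.+1)
    [seq crossO r u v | u <- unzip1 (LX p), v <- unzip1 (LY (r - p)%N)].
  rewrite /LZ (big_morph (@unzip1 _ _) (id1 := [::]) (op1 := cat)) => [|s t|//];
    last exact: map_cat.
  apply: eq_bigr => p _; rewrite /F /unzip1 map_allpairs allpairs_mapl allpairs_mapr.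
  by [].
have LZ2 : unzip2 LZ = \big[cat/[::]]_(p < r.+1) msum (unzip2 (LX p)) (unzip2 (LY (r - p)%N)).
  rewrite /LZ (big_morph (@unzip2 _ _) (id1 := [::]) (op1 := cat)) => [|s t|//];
    last exact: map_cat.
  by apply: eq_bigr => p _; rewrite /F /unzip2 /msum map_allpairs allpairs_mapl allpairs_mapr.
apply: (@perm_trans _ (unzip2 LZ)); last first.
  rewrite LZ2; elim/big_ind2: _ => // [s s' t t'|p _]; first exact: perm_cat.
  have [_ _ bX eX] := LXP p; have [_ _ bY eY] := LYP (r - p)%N.
  by apply: perm_allpairs; rewrite perm_sym; apply: spec_eigenbasis.
apply: spec_eigenbasis.
  rewrite LZ1; apply: (@orth_basis _ _ (@innerO R (box X Y) r)).
  - exact: innerO_l.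
  - exact: innerOC.
  - exact: innerO_eq0.
  - apply: (@all_bigcat _ _ _ (fun p =>
      [seq crossO r u v | u <- unzip1 (LX p), v <- unzip1 (LY (r - p)%N)])) => p pr.
    have rpq : r = (p + (r - p))%N by rewrite subnKC.
    have [nX _ _ _] := LXP p; have [nY _ _ _] := LYP (r - p)%N.
    apply: all_allpairs nX nY => u v u0 v0; apply/eqP => uv0.
    have := innerO_cross u v u v rpq rpq; rewrite uv0 /innerO inner0l -!innerE.
    move/esym/eqP; rewrite mulf_eq0 => /orP[] /eqP /inner_eq0 e0.
      by case/eqP: u0; apply: val_inj.
    by case/eqP: v0; apply: val_inj.
  - apply: (@pairwise_bigcat _ _ _ (fun p =>
      [seq crossO r u v | u <- unzip1 (LX p), v <- unzip1 (LY (r - p)%N)]))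
      => [p pr|i j /andP[ij jr]].
      have rpq : r = (p + (r - p))%N by rewrite subnKC.
      have [_ pX _ _] := LXP p; have [_ pY _ _] := LYP (r - p)%N.
      apply: pairwise_allpairs pX pY => [u v u' v'|u v v'] /eqP o; apply/eqP;
      rewrite (innerO_cross _ _ _ _ rpq rpq) -!innerE.
        by rewrite [X in X * _]o mul0r.
      by rewrite [X in _ * X]o mulr0.
    (* Cross products of different bidegrees are orthogonal. *)
    have ri : r = (i + (r - i))%N by rewrite subnKC // -ltnS (ltn_trans ij).
    have rj : r = (j + (r - j))%N by rewrite subnKC.
    apply/allrelP => _ _ /allpairsP[[u v] [_ _ ->]] /allpairsP[[u' v'] [_ _ ->]].
    by apply/eqP; rewrite (innerO_cross _ _ _ _ ri rj) pairing_size ?mul0r // ltn_eqF.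
  - move=> w Hw; apply: val_inj; apply: Omega_cross_orth; first exact: subvsP.
    move=> p q u v rpq Ou Ov.
    have pr : (p < r.+1)%N by rewrite ltnS rpq leq_addr.
    have qE : q = (r - p)%N by rewrite rpq addKn.
    subst q; have [_ _ bX _] := LXP p; have [_ _ bY _] := LYP (r - p)%N.
    (* By bilinearity, w is orthogonal to all cross products, not only to those of
       basis vectors. *)
    have H x y : x \in unzip1 (LX p) -> y \in unzip1 (LY (r - p)%N) ->
        innerO (crossO r x y) w = 0.
      move=> xL yL; rewrite innerOC; apply: Hw.
      apply: (@mem_bigcat _ _ (fun p =>
        [seq crossO r u v | u <- unzip1 (LX p), v <- unzip1 (LY (r - p)%N)])) pr _.
      exact: allpairs_f.
    have H1 x : x \in unzip1 (LX p) ->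
        forall y : subvs_of (Omega R Y (r - p)), innerO (crossO r x y) w = 0.
      move=> xL y; apply: (@linear_eq0_span _ _ (fun y => innerO (crossO r x y) w)
         (unzip1 (LY (r - p)%N)) _ _ y).
      - by move=> k y1 y2; rewrite crossODr crossOZr innerO_l.
      - by move=> y' yL; apply: H.
      - by rewrite (span_basis bY) memvf.
    have H2 (x : subvs_of (Omega R X p)) (y : subvs_of (Omega R Y (r - p))) :
        innerO (crossO r x y) w = 0.
      apply: (@linear_eq0_span _ _ (fun x => innerO (crossO r x y) w) (unzip1 (LX p)) _ _ x).
      - by move=> k x1 x2; rewrite crossODl crossOZl innerO_l.
      - by move=> x' xL; apply: H1.
      - by rewrite (span_basis bX) memvf.
    by have := H2 (Subvs Ou) (Subvs Ov); rewrite /innerO crossOE.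
have eZ : all (fun x => Laplacian R (box X Y) r x.1 == x.2 *: x.1) LZ.
  apply: all_bigcat => p pr; have rpq : r = (p + (r - p))%N by rewrite subnKC.
  have [_ _ _ eX] := LXP p; have [_ _ _ eY] := LYP (r - p)%N.
  apply: (all_allpairs (a := fun x => Laplacian R X p x.1 == x.2 *: x.1)
    (b := fun y => Laplacian R Y (r - p) y.1 == y.2 *: y.1)).
  - move=> x y /eqP ex /eqP ey; apply/eqP.
    by rewrite Laplacian_cross // ex ey crossOZl crossOZr -scalerDl.
  - by apply/allP => x /eX ->.
  - by apply/allP => y /eY ->.
by move=> x xL; apply/eqP; apply: (allP eZ).
Qed.
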